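(* For any integer $m\ge 2$ there exist global rotating solutions of the two-dimensional incompressible Euler equation in vorticity form which have $C^2$ regularity, compact support and $m$-fold symmetry.
   Context: The 2D Euler equation in vorticity form is $\partial_t\omega+v\cdot\nabla\omega=0$ for $(x,t)\in\mathbb{R}^2\times\mathbb{R}_+$, with $v=\nabla^\perp(-\Delta)^{-1}\omega$, where $\nabla^\perp=(\partial_{x_2},-\partial_{x_1})$. A global rotating solution is a solution $\omega$ defined for all times whose level sets rotate with constant angular velocity: there is $\lambda\in\mathbb{R}$ such that $\omega(\mathcal{O}(t)x,t)=\omega(x,0)$ for all $x\in\mathbb{R}^2$, $t\ge0$, where $\mathcal{O}(t)=\begin{pmatrix}\cos(\lambda t)&\sin(\lambda t)\\-\sin(\lambda t)&\cos(\lambda t)\end{pmatrix}$. $m$-fold symmetry means invariance under rotation by the angle $\frac{2\pi}{m}$. $C^2$ regularity and compact support refer to the vorticity $\omega(\cdot,t)$ as a function on $\mathbb{R}^2$. *)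

(* Defs.v *)
(* The plane is R * R for an arbitrary R : realType. *)
From HB Require Import structures.
From mathcomp Require Import all_boot all_order all_algebra.
From mathcomp Require Import all_classical all_reals all_analysis.

Set Implicit Arguments.
Unset Strict Implicit.
Unset Printing Implicit Defensive.

Import Order.TTheory GRing.Theory Num.Theory.
Import numFieldNormedType.Exports.

Local Open Scope classical_set_scope.
Local Open Scope ring_scope.

Section EulerPlane.
Variable R : realType.
Implicit Types (f psi : R * R -> R) (w : R * R -> R -> R).
Implicit Types (x : R * R) (t a : R).

Definition e1 : R * R := (1, 0).
Definition e2 : R * R := (0, 1).

Definition partial1 f x : R := 'D_e1 f x.
Definition partial2 f x : R := 'D_e2 f x.

Definition has_partials f := forall x, derivable f x e1 /\ derivable f x e2.

Fixpoint Ck (k : nat) f : Prop :=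
  if k is k'.+1 then
    has_partials f /\ Ck k' (partial1 f) /\ Ck k' (partial2 f) /\ continuous f
  else continuous f.

Definition compactly_supported f := compact (closure [set x | f x != 0]).

(* The library's norm on R * R is the sup norm, hence this definition. *)
Definition enorm x : R := Num.sqrt (x.1 ^+ 2 + x.2 ^+ 2).

Definition plane_measure : set (R * R) -> \bar R :=
  (@lebesgue_measure R \x @lebesgue_measure R)%E.

(* (-Delta)^-1 as the convolution with the fundamental solution
   - ln |x| / (2 pi) of -Delta.  The integral converges absolutely when f is
   continuous with compact support; the value ln 0 = 0 on the diagonal is
   irrelevant, a point being negligible. *)
Definition inv_neg_laplacian f x : R :=
  \int[plane_measure]_(y in [set: R * R])
    (- (2 * pi)^-1 * ln (enorm (x - y)) * f y).

Definition perp_grad psi x : R * R := (partial2 psi x, - partial1 psi x).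

Definition velocity f : R * R -> R * R := perp_grad (inv_neg_laplacian f).

(* d is the derivative of g at t relative to [0, +oo[: two-sided for t > 0,
   right derivative for t = 0. *)
Definition is_time_derivative (g : R -> R) t (d : R) :=
  h^-1 * (g (t + h) - g t) @[h --> within [set h | 0 <= t + h] 0^'] --> d.

(* Classical solutions of  d_t w + v . grad w = 0  on R^2 x [0, +oo[, where
   w x t is the vorticity at x and time t; its values at t < 0 play no role.
   The existence of the spatial derivatives is required, because 'D_e takes
   unspecified values where it does not exist. *)
Definition euler_vorticity_solution w := forall t, 0 <= t ->
  [/\ has_partials (w^~ t),
      has_partials (inv_neg_laplacian (w^~ t)) &
      forall x, is_time_derivative (w x) t
        (- ((velocity (w^~ t) x).1 * partial1 (w^~ t) x
            + (velocity (w^~ t) x).2 * partial2 (w^~ t) x))].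

(* x |-> (cos a, sin a; - sin a, cos a) x *)
Definition rot a x : R * R :=
  (cos a * x.1 + sin a * x.2, - sin a * x.1 + cos a * x.2).

Definition global_rotating_solution w :=
  euler_vorticity_solution w /\
  exists lambda : R, forall x t, 0 <= t -> w (rot (lambda * t) x) t = w x 0.

(* Radial vorticities (in particular 0) are time-independent solutions
   satisfying the rotation condition for every lambda, and nonradial steady
   states satisfy it with lambda = 0.  A rotating solution which is not
   stationary has lambda <> 0 and a nonradial vorticity. *)
Definition stationary w := forall x t, 0 <= t -> w x t = w x 0.

Definition fold_symmetric (m : nat) f :=
  forall x, f (rot (2 * pi / m%:R) x) = f x.

End EulerPlane.

(* Main.v *)
(* In a disc where the flow is a rigid rotation of angular velocity [lambda], add
   disjoint copies of a small radial vortex of zero total vorticity, centered at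
   the vertices of a regular [m]-gon.  Each vortex induces no velocity outside
   its support and leaves itself invariant, so that it is merely carried by the
   rigid rotation: the whole pattern rotates.  The rigid rotation is produced by
   a radial vorticity, again of zero total mass, supported in a larger disc.

   Every stream function in sight is a finite combination of the functions
   [max (A - |x - c|^2, 0) ^ 5]; being compactly supported, it is recovered from
   the vorticity by the logarithmic potential.  This representation formula is
   proved without polar coordinates: with [(a, b) = y - x] and
   [atan (a / b) + atan (b / a) = pi / 2 * sgn (a * b)], the integrand
   [ln |y - x| * Lap psi] is the sum of two pure derivatives, which integrate to
   zero on almost every line, and of [pi / 2 * sgn (a * b) * d1 d2 psi], whose
   integral is [2 * pi * psi x]. *)
Require Import Defs.
From HB Require Import structures.
From mathcomp Require Import all_boot all_order all_algebra.
From mathcomp Require Import all_classical all_reals all_analysis.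
From mathcomp Require Import measurable_realfun.
From mathcomp Require Import ring lra.

Import Order.TTheory GRing.Theory Num.Theory.
Import numFieldNormedType.Exports.

Local Open Scope classical_set_scope.
Local Open Scope ring_scope.

(** * One-variable calculus and measurability *)

Section Derive.
Context {R : realType}.
Implicit Types (f g : R -> R) (t a b d : R).

Lemma is_derive1N f t a : is_derive t (1 : R) f a ->
  is_derive t (1 : R) (fun s => - f s) (- a).
Proof. by move=> ?; exact: is_deriveN. Qed.

Lemma is_derive1Z f (k : R) t a : is_derive t (1 : R) f a ->
  is_derive t (1 : R) (fun s => k * f s) (k * a).
Proof. by move=> fa; exact: is_deriveZ. Qed.

Lemma is_derive1_comp_fun f g t a b :
  is_derive (g t) (1 : R) f a -> is_derive t (1 : R) g b ->
  is_derive t (1 : R) (fun s => f (g s)) (a * b).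
Proof. by move=> ? ?; exact: is_derive1_comp. Qed.

Lemma is_derive1_continuous f t a : is_derive t (1 : R) f a -> {for t, continuous f}.
Proof.
by case=> df _; apply: differentiable_continuous; apply/derivable1_diffP.
Qed.

End Derive.

(** * Measurability on the line and in the plane *)

Section Measurable.
Context {R : realType}.

(** The formula [x * expR (- (2 * ln |x|))] is a product of measurable functions, and its factor [x]
    makes it agree with the convention [0^-1 = 0]. *)
Lemma measurable_inv : measurable_fun [set: R] (fun x : R => x^-1).
Proof.
rewrite (_ : (fun x : R => x^-1) = fun x => x * expR (- (2 * ln `|x|))).
  apply: measurable_funM => //.
  apply: (measurableT_comp (@measurable_expR R)).
  apply: measurable_funN; apply: measurable_funM => //.
  by apply: (measurableT_comp (@measurable_ln R)); exact: normr_measurable.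
apply/funext => x; have [->|x0] := eqVneq x 0; first by rewrite invr0 mul0r.
have nx : 0 < `|x| by rewrite normr_gt0.
rewrite expRN mulr_natl mulr2n expRD lnK ?posrE// -expr2 real_normK ?num_real//.
by rewrite expr2 invfM mulrA divff// mul1r.
Qed.

Lemma measurable_atan : measurable_fun [set: R] (@atan R).
Proof. by apply: continuous_measurable_fun => x; exact: continuous_atan. Qed.

Lemma measurable_sqrt : measurable_fun [set: R] (@Num.sqrt R).
Proof. by apply: continuous_measurable_fun; exact: sqrt_continuous. Qed.

Lemma measurable_sgr : measurable_fun [set: R] (@Num.sg R).
Proof.
rewrite (_ : @Num.sg R = fun x => x * `|x|^-1); last first.
  apply/funext => x; have [->|x0] := eqVneq x 0; first by rewrite sgr0 mul0r.
  by rewrite [X in _ = X / _]numEsg mulfK// normr_eq0.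
apply: measurable_funM => //.
by apply: (measurableT_comp measurable_inv); exact: normr_measurable.
Qed.

(** Measurability refers to the product structure, so [O] is written as a countable union of
    rectangles: those with rational centres and radii [1 / (n + 1)] that lie inside [O]. *)
Lemma open_prod_measurable (O : set (R * R)) : open O -> measurable O.
Proof.
move=> oO.
pose box (i : rat * rat * nat) : set (R * R) :=
  ball (ratr i.1.1 : R) i.2.+1%:R^-1 `*` ball (ratr i.1.2 : R) i.2.+1%:R^-1.
pose S (i : rat * rat * nat) := if `[< box i `<=` O >] then box i else set0.
rewrite (_ : O = \bigcup_i S i).
  apply: countable_bigcupT_measurable => [|i]; first exact: countableP.
  rewrite /S.
  by case: ifP => // _; apply: measurableX; exact: measurable_ball.
apply/seteqP; split => [x Ox|x [i _]]; last first.
  by rewrite /S; case: asboolP => // + bx; exact.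
have /nbhs_ballP[e /= e0 xeO] := open_nbhs_nbhs (conj oO Ox).
have [n] : exists n, 0 + n.+1%:R^-1 < e / 2 by apply: ltr_add_invr; rewrite divr_gt0.
rewrite add0r => ne.
have [q] : exists q, ratr q \in `]x.1 - n.+1%:R^-1, x.1 + n.+1%:R^-1[.
  by apply: rat_in_itvoo; rewrite ltrBlDr -addrA ltrDl addr_gt0// invr_gt0.
rewrite in_itv/= => /andP[q1 q2].
have [r] : exists r, ratr r \in `]x.2 - n.+1%:R^-1, x.2 + n.+1%:R^-1[.
  by apply: rat_in_itvoo; rewrite ltrBlDr -addrA ltrDl addr_gt0// invr_gt0.
rewrite in_itv/= => /andP[r1 r2].
exists (q, r, n) => //; rewrite /S; case: asboolP => [_|].
  by split; rewrite /ball /= ltr_distl ?q1 ?r1.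
case=> y [/= y1 y2]; apply: xeO; move: y1 y2.
rewrite /ball /= (distrC _ y.1) (distrC _ y.2) !ltr_distl.
move: ne q1 q2 r1 r2; move: n.+1%:R^-1 (ratr q) (ratr r) => d q' r' ne q1 q2 r1 r2.
move=> /andP[a1 a2] /andP[b1 b2].
by split; rewrite /ball /= ltr_distl; apply/andP; split; lra.
Qed.

Lemma continuous2_measurable (f : R * R -> R) :
  continuous f -> measurable_fun [set: R * R] f.
Proof.
move=> /continuousP cf; apply: (measurability _ (RGenOpens.measurableE R)).
move=> _ [_ [a [b ->] <-]]; rewrite setTI.
by apply: open_prod_measurable; apply: cf; exact: interval_open.
Qed.

End Measurable.

(** * Integrals of derivatives on the line *)

Section OneDim.
Context {R : realType}.
Local Notation mu := (@lebesgue_measure R).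

Lemma integral_derive (u du : R -> R) (a b : R) : a <= b ->
  {in `[a, b], forall t : R, is_derive t (1 : R) u (du t)} ->
  {within `[a, b], continuous du} ->
  (\int[mu]_(t in `[a, b]) (du t)%:E = (u b - u a)%:E)%E.
Proof.
rewrite le_eqVlt => /predU1P[<- _ _|ab ud cdu].
  by rewrite set_itv1 integral_set1 subrr.
have cu t : t \in `[a, b] -> {for t, continuous u}.
  by move=> /ud; exact: is_derive1_continuous.
rewrite EFinB (@continuous_FTC2 _ _ u _ _ ab cdu)//.
  split.
  - by move=> t tab; case: (ud t (subset_itv_oo_cc tab)).
  - by apply: cvg_at_right_filter; apply: cu; rewrite bound_itvE ltW.
  - by apply: cvg_at_left_filter; apply: cu; rewrite bound_itvE ltW.
move=> t tab; rewrite derive1E.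
by have [_ ->] := ud t (subset_itv_oo_cc tab).
Qed.

Section compact_support.
Variables (u du : R -> R) (M : R).
Hypothesis ud : forall t : R, is_derive t (1 : R) u (du t).
Hypothesis cdu : continuous du.
Hypothesis u0 : forall t, M <= `|t| -> u t = 0.
Hypothesis du0 : forall t, M <= `|t| -> du t = 0.

Let measurable_du (A : set R) : measurable_fun A (EFin \o du).
Proof.
by apply/measurable_EFinP; apply: measurable_funTS; exact: continuous_measurable_fun.
Qed.

Let integrable_du (A : set R) : measurable A -> mu.-integrable A (EFin \o du).
Proof.
move=> mA; apply: (@integrableS _ _ _ _ setT) => //.
have -> : EFin \o du = (EFin \o du) \_ `[- M, M].
  apply/funext => t; rewrite patchE; case: ifPn => // /negP tM /=.
  rewrite du0//; have [//|tM'] := leP M `|t|; exfalso; apply: tM.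
  by rewrite inE /= in_itv/= -ler_norml ltW.
apply/integrable_restrict => //; rewrite setTI.
apply: continuous_compact_integrable; first exact: segment_compact.
exact: continuous_subspaceT.
Qed.

Let integral_du_le (c : R) : (\int[mu]_(t in `]-oo, c]) (du t)%:E = (u c)%:E)%E.
Proof.
(* Taking [N] above [|c|] as well makes [[- N, c]] a genuine interval, on which the fundamental
   theorem applies. *)
pose N : R := Num.max M `|c|.
have MN : M <= N by rewrite le_max lexx.
have cN : `|c| <= N by rewrite le_max lexx orbT.
have NN : - N <= c by move: cN; rewrite ler_norml => /andP[].
have N0 : 0 <= N by rewrite (le_trans _ cN).
rewrite (_ : `]-oo, c]%classic = `]-oo, (- N)[%classic `|` `[- N, c]%classic); last first.
  by rewrite -itv_bndbnd_setU// bnd_simp.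
rewrite integral_setU//=; last 2 first.
- exact: measurable_du.
- by apply/lt_disjoint => x y; rewrite /= !in_itv/= => xN /andP[/(lt_le_trans xN)].
rewrite (@integral_derive u)//; last exact: continuous_subspaceT.
rewrite (u0 (- N)) ?subr0; last by rewrite normrN ger0_norm.
rewrite integral0_eq ?add0e// => t /=; rewrite in_itv/= => tN.
rewrite du0//; apply: (le_trans MN); rewrite ltr0_norm; first by rewrite lerNr ltW.
by apply: (lt_le_trans tN); rewrite oppr_le0.
Qed.

Lemma integral_derive_support : (\int[mu]_t (du t)%:E = 0)%E.
Proof.
pose N : R := Num.max M 0.
have MN : M <= N by rewrite le_max lexx.
have N0 : 0 <= N by rewrite le_max lexx orbT.
rewrite (_ : setT = `]-oo, N]%classic `|` `]N, +oo[%classic); last first.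
  by rewrite -itv_bndbnd_setU// set_itvE.
rewrite integral_setU//=; last 2 first.
- exact: measurable_du.
- by apply/lt_disjoint => x y; rewrite /= !in_itv/= andbT; exact: le_lt_trans.
rewrite integral_du_le u0 ?ger0_norm// add0e.
rewrite integral0_eq// => t /=; rewrite in_itv/= andbT => tN.
by rewrite du0// (le_trans MN)// ltW// (lt_le_trans tN)// ler_norm.
Qed.

(** Off the null set [{c}] the integrand is [du] minus twice its restriction to []-oo, c]]; the
    first part integrates to 0, the second to [2 * u c]. *)
Lemma integral_sgr_derive_support (c : R) :
  (\int[mu]_t (Num.sg (t - c) * du t)%:E = (- (2 * u c))%:E)%E.
Proof.
have mdu := continuous_measurable_fun cdu.
have E : (\int[mu]_t (Num.sg (t - c) * du t)%:E =
    \int[mu]_t ((du t)%:E - 2%:E * ((EFin \o du) \_ `]-oo, c]) t))%E.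
  apply: ae_eq_integral => //.
  - apply/measurable_EFinP; apply: measurable_funM => //.
    apply: (measurableT_comp measurable_sgr).
    by apply: measurable_funB.
  - apply: emeasurable_funB; first exact/measurable_EFinP.
    apply: emeasurable_funM => //; apply/(measurable_restrictT _ _).1 => //.
    by apply/measurable_EFinP; exact: measurable_funTS.
  exists [set c]; split => //; first exact: lebesgue_measure_set1.
  move=> t /= tc; apply: contrapT => /eqP tc'; apply: tc => _.
  rewrite patchE; case: ifPn; rewrite ?inE ?notin_setE /= in_itv/=.
    rewrite le_eqVlt (negbTE tc')/= => {}tc'.
    by rewrite ltr0_sg ?subr_lt0//= -EFinD; congr EFin; ring.
  move=> /negP; rewrite -ltNge => {}tc'.
  by rewrite gtr0_sg ?subr_gt0//= mul1r mulr0 oppr0 -EFinD addr0.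
rewrite E integralB//=; last 2 first.
- exact: integrable_du.
- apply: integrableZl => //; apply/integrable_restrict => //.
  by rewrite setTI; exact: integrable_du.
rewrite integral_derive_support add0e integralZl//; last first.
  by apply/integrable_restrict => //; rewrite setTI; exact: integrable_du.
by rewrite -integral_mkcond integral_du_le.
Qed.

End compact_support.
End OneDim.

(** * Integrability of the logarithmic kernel *)

Section Weight.
Context {R : realType}.
Local Notation mu := (@lebesgue_measure R).

(* The value at [t = c] is [0^-1 = 0]. *)
Definition rsqrt_weight (c B t : R) : R :=
  if `|t - c| <= B then (Num.sqrt `|t - c|)^-1 else 0.

Lemma rsqrt_weight_ge0 c B t : 0 <= rsqrt_weight c B t.
Proof. by rewrite /rsqrt_weight; case: ifP => //; rewrite invr_ge0 sqrtr_ge0. Qed.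

Lemma measurable_rsqrt c : measurable_fun [set: R] (fun t => (Num.sqrt `|t - c|)^-1).
Proof.
apply: (measurableT_comp measurable_inv).
apply: (measurableT_comp measurable_sqrt).
by apply: (measurableT_comp (@normr_measurable R setT)); exact: measurable_funB.
Qed.

Lemma measurable_rsqrt_weight c B : measurable_fun [set: R] (rsqrt_weight c B).
Proof.
apply: measurable_fun_ifT => //; last exact: measurable_rsqrt.
apply: measurable_fun_ler => //.
by apply: (measurableT_comp (@normr_measurable R setT)); exact: measurable_funB.
Qed.

(** An antiderivative is [2 * sqrt (t - c)]. The bound is uniform in [d], which can thus be sent to
    0. *)
Lemma integral_rsqrt_right (c d e : R) : 0 < d -> d <= e ->
  (\int[mu]_(t in `[(c + d)%R, (c + e)%R]) (Num.sqrt `|t - c|)^-1%:E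
    <= (2 * Num.sqrt e)%:E)%E.
Proof.
move=> d0 de.
have cdt t : t \in `[c + d, c + e] -> 0 < t - c.
  by rewrite in_itv/= => /andP[h _]; rewrite subr_gt0 (lt_le_trans _ h)// ltrDl.
rewrite (@integral_derive _ (fun t => 2 * Num.sqrt (t - c))
  (fun t => (Num.sqrt `|t - c|)^-1)).
- by rewrite lee_fin addrAC subrr add0r gerBl mulr_ge0// sqrtr_ge0.
- by rewrite lerD2l.
- move=> t /cdt tc; rewrite gtr0_norm//.
  have s0 : Num.sqrt (t - c) != 0 by rewrite sqrtr_eq0 -ltNge.
  apply: is_derive_eq; first apply: is_derive1Z.
    apply: is_derive1_comp_fun; first exact: is_derive1_sqrt.
  by field.
- apply: continuous_in_subspaceT => t /set_mem/cdt tc.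
  apply: cvgV; first by rewrite sqrtr_eq0 normr_le0 gt_eqF.
  apply: (continuous_comp (f := fun t => `|t - c|)); last exact: sqrt_continuous.
  apply: continuous_comp; last exact: norm_continuous.
  by apply: cvgB => //; exact: cvg_cst.
Qed.

Lemma integral_rsqrt_left (c d e : R) : 0 < d -> d <= e ->
  (\int[mu]_(t in `[(c - e)%R, (c - d)%R]) (Num.sqrt `|t - c|)^-1%:E
    <= (2 * Num.sqrt e)%:E)%E.
Proof.
move=> d0 de.
have cdt t : t \in `[c - e, c - d] -> 0 < c - t.
  rewrite in_itv/= => /andP[_ h]; rewrite subr_gt0 (le_lt_trans h)//.
  by rewrite gtrBl.
rewrite (@integral_derive _ (fun t => - (2 * Num.sqrt (c - t)))
  (fun t => (Num.sqrt `|t - c|)^-1)).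
- have -> : c - (c - d) = d by ring.
  have -> : c - (c - e) = e by ring.
  by rewrite lee_fin opprK gerDr oppr_le0 mulr_ge0// sqrtr_ge0.
- by rewrite lerB.
- move=> t /cdt tc; rewrite distrC gtr0_norm//.
  have s0 : Num.sqrt (c - t) != 0 by rewrite sqrtr_eq0 -ltNge.
  apply: is_derive_eq; first apply: is_derive1N; first apply: is_derive1Z.
    apply: is_derive1_comp_fun; first exact: is_derive1_sqrt.
  by field.
- apply: continuous_in_subspaceT => t /set_mem/cdt tc.
  apply: cvgV; first by rewrite sqrtr_eq0 normr_le0 subr_eq0 lt_eqF// -subr_gt0.
  apply: (continuous_comp (f := fun t => `|t - c|)); last exact: sqrt_continuous.
  apply: continuous_comp; last exact: norm_continuous.
  by apply: cvgB => //; exact: cvg_cst.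
Qed.

Lemma integral_rsqrt_annulus (c d e : R) : 0 < d ->
  (\int[mu]_(t in [set t | (d <= `|t - c|)%R && (`|t - c| <= e)%R])
      (Num.sqrt `|t - c|)^-1%:E
    <= (4 * Num.sqrt e)%:E)%E.
Proof.
move=> d0; have [de|ed] := leP d e; last first.
  rewrite [X in integral _ X](_ : _ = set0) ?integral_set0 ?lee_fin ?mulr_ge0 ?sqrtr_ge0//.
  apply/seteqP; split => // t /= /andP[/le_trans] /[apply].
  by rewrite leNgt ed.
rewrite [X in integral _ X](_ : _ =
  `[c - e, c - d]%classic `|` `[c + d, c + e]%classic); last first.
  apply/seteqP; split => t /=; rewrite !in_itv/=.
    move=> /andP[]; rewrite ler_distl => + /andP[h1 h2].
    by rewrite ler_normr; case/orP => h; [right|left]; apply/andP; split; lra.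
  rewrite ler_distl ler_normr => -[] /andP[h1 h2]; (apply/andP; split);
    try (by apply/andP; split; lra); apply/orP; by [left; lra|right; lra].
rewrite integral_setU//=.
- rewrite (_ : 4 * _ = 2 * Num.sqrt e + 2 * Num.sqrt e); last by ring.
  by rewrite EFinD; apply: leeD;
    [exact: integral_rsqrt_left|exact: integral_rsqrt_right].
- by apply/measurable_EFinP; apply: measurable_funTS; exact: measurable_rsqrt.
- by apply/lt_disjoint => x y; rewrite /= !in_itv/= => /andP[_ h1] /andP[h2 _]; lra.
Qed.

(** The annuli [1 / (n + 1) <= |t - c| <= B] exhaust the punctured interval; by monotone convergence
    the integral inherits their common bound [4 * sqrt B]. *)
Lemma integrable_rsqrt_weight c B : mu.-integrable setT (EFin \o rsqrt_weight c B).
Proof.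
apply/integrableP; split.
  by apply/measurable_EFinP; exact: measurable_rsqrt_weight.
pose S (n : nat) := [set t : R | (n.+1%:R^-1 <= `|t - c|) && (`|t - c| <= B)].
pose g t := ((Num.sqrt `|t - c|)^-1)%:E.
have mnorm : measurable_fun [set: R] (fun t : R => `|t - c|).
  by apply: (measurableT_comp (@normr_measurable R setT)); exact: measurable_funB.
have mS n : measurable (S n).
  rewrite -[S n]setTI; apply: (@measurable_and _ _ setT
    (fun t : R => n.+1%:R^-1 <= `|t - c|) (fun t => `|t - c| <= B)) => //.
  - exact: measurable_fun_ler.
  - exact: measurable_fun_ler.
have ndS : nondecreasing_seq S.
  move=> m n mn; apply/subsetPset => t; rewrite /S/= => /andP[h ->]; rewrite andbT.
  by apply: le_trans h; rewrite lef_pV2 ?posrE ?ltr0n// ler_nat.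
have mg A : measurable_fun A g.
  by apply/measurable_EFinP; apply: measurable_funTS; exact: measurable_rsqrt.
have cvgS : (\int[mu]_(t in S n) g t)%E @[n --> \oo] -->
    (\int[mu]_(t in \bigcup_n S n) g t)%E.
  apply: ge0_nondecreasing_set_cvg_integral => //.
    by move=> n; exact: mg.
  by move=> n t Snt; rewrite lee_fin invr_ge0 sqrtr_ge0.
rewrite (_ : \int[mu]_x `|(EFin \o rsqrt_weight c B) x| =
  \int[mu]_(t in \bigcup_n S n) g t)%E; last first.
  rewrite [RHS]integral_mkcond; apply: eq_integral => t _ /=.
  rewrite ger0_norm ?rsqrt_weight_ge0// /rsqrt_weight patchE.
  (* The centre lies in no annulus, and [0^-1 = 0] makes the weight vanish there too. *)
  have [->|tc] := eqVneq t c.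
    by rewrite subrr normr0 sqrtr0 invr0 /g subrr normr0 sqrtr0 invr0 !if_same.
  have tc0 : 0 < `|t - c| by rewrite normr_gt0 subr_eq0.
  have [n] : exists n, 0 + n.+1%:R^-1 < `|t - c| by apply: ltr_add_invr.
  rewrite add0r => /ltW nt; case: ifPn => tB.
    by rewrite ifT// inE; exists n => //; apply/andP.
  by rewrite ifF//; apply/negbTE; rewrite notin_setE => -[k _ /andP[_]]; exact/negP.
apply: (@le_lt_trans _ _ (4 * Num.sqrt B)%:E); last exact: ltry.
rewrite -(cvg_lim _ cvgS)//; apply: lime_le; first by apply: cvgP; exact: cvgS.
by apply: nearW => n; apply: integral_rsqrt_annulus; rewrite invr_gt0.
Qed.

End Weight.

(** * The logarithm, the arctangent and their flux along lines *)

Section Kernel.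
Context {R : realType}.
Local Notation mu := (@lebesgue_measure R).

(** By oddness it suffices to treat [z > 0], where the two arctangents are complementary angles:
    [tan (pi / 2 - atan z) = z^-1]. At [z = 0] the convention [0^-1 = 0] makes both sides vanish. *)
Lemma atanD_inv (z : R) : atan z + atan z^-1 = pi / 2 * Num.sg z.
Proof.
wlog z0 : z / 0 < z => [pos|].
  have [z0|z0|->] := ltgtP z 0; last by rewrite invr0 atan0 sgr0 mulr0 addr0.
    have := pos (- z); rewrite oppr_gt0 => /(_ z0).
    rewrite invrN !atanN sgrN mulrN => /eqP; rewrite -opprD eqr_opp.
    by move/eqP.
  exact: pos.
rewrite gtr0_sg// mulr1.
have a0 : 0 < atan z by rewrite -atan0 lt_atan.
have a1 := atan_ltpi2 z.
have <- : tan (pi / 2 - atan z) = z^-1.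
  rewrite /tan sinB cosB sin_pihalf cos_pihalf !mul1r !mul0r subr0 add0r.
  by rewrite -invf_div -/(tan (atan z)) atanK.
rewrite tanK; first by rewrite addrC subrK.
by rewrite in_itv/=; apply/andP; split; lra.
Qed.

Definition lnr (a b : R) : R := ln (Num.sqrt (a ^+ 2 + b ^+ 2)).

Lemma sqr_sum_gt0 (a b : R) : b != 0 -> 0 < a ^+ 2 + b ^+ 2.
Proof. by move=> b0; rewrite ltr_wpDl ?sqr_ge0// lt0r sqr_ge0 expf_neq0. Qed.

Lemma is_derive_lnr (t c b : R) : b != 0 ->
  is_derive t (1 : R) (fun s => lnr (s - c) b) ((t - c) / ((t - c) ^+ 2 + b ^+ 2)).
Proof.
move=> b0; have q0 := sqr_sum_gt0 (t - c) b b0.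
have s0 : 0 < Num.sqrt ((t - c) ^+ 2 + b ^+ 2) by rewrite sqrtr_gt0.
apply: is_derive_eq.
  apply: is_derive1_comp_fun; first exact: is_derive1_ln.
  apply: is_derive1_comp_fun; first exact: is_derive1_sqrt.
have q2 : (t - c) ^+ 2 + b ^+ 2 = Num.sqrt ((t - c) ^+ 2 + b ^+ 2) ^+ 2.
  by rewrite sqr_sqrtr// ltW.
rewrite /GRing.scale/= [in RHS]q2; field.
by rewrite gt_eqF.
Qed.

Lemma is_derive_atan_div (t c b : R) : b != 0 ->
  is_derive t (1 : R) (fun s => atan ((s - c) / b)) (b / ((t - c) ^+ 2 + b ^+ 2)).
Proof.
move=> b0; have q0 := sqr_sum_gt0 (t - c) b b0.
apply: is_derive_eq.
by rewrite /GRing.scale/=; field; rewrite gt_eqF.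
Qed.

(* The derivative in [a] of [ln |(a, b)| * q1 - atan (a / b) * q2], where [q11]
   and [q12] are the derivatives of [q1] and [q2]. *)
Definition green_flux (a b q1 q11 q2 q12 : R) : R :=
  a / (a ^+ 2 + b ^+ 2) * q1 + lnr a b * q11 -
  (b / (a ^+ 2 + b ^+ 2) * q2 + atan (a / b) * q12).

Lemma continuous_pole (c b : R) : b != 0 ->
  continuous (fun s : R => ((s - c) ^+ 2 + b ^+ 2)^-1).
Proof.
move=> b0 s; apply: cvgV; first by rewrite gt_eqF// sqr_sum_gt0.
apply: cvgD; last exact: cvg_cst.
apply: (continuous_comp (f := fun s => s - c) (g := fun s => s ^+ 2)).
  by apply: cvgB => //; exact: cvg_cst.
exact: exprn_continuous.
Qed.

(** On a line that avoids the pole, the flux is the derivative of [ln |(t - c, b)| * q1 - atan ((t -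
    c) / b) * q2], a function with compact support. *)
Lemma integral_green_flux_slice (q1 q11 q2 q12 : R -> R) (c b M : R) : b != 0 ->
  (forall t : R, is_derive t (1 : R) q1 (q11 t)) ->
  (forall t : R, is_derive t (1 : R) q2 (q12 t)) ->
  continuous q11 -> continuous q12 ->
  (forall t, M <= `|t| -> [/\ q1 t = 0, q11 t = 0, q2 t = 0 & q12 t = 0]) ->
  (\int[mu]_t (green_flux (t - c) b (q1 t) (q11 t) (q2 t) (q12 t))%:E = 0)%E.
Proof.
move=> b0 d1 d2 c11 c12 q0.
apply: (@integral_derive_support _
  (fun t => lnr (t - c) b * q1 t - atan ((t - c) / b) * q2 t) _ M).
- move=> t; have d3 := is_derive_lnr t c b b0; have d4 := is_derive_atan_div t c b b0.
  apply: is_derive_eq.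
  by rewrite /green_flux /GRing.scale/=; ring.
- move=> t; apply: cvgB; apply: cvgD; apply: cvgM.
  + apply: cvgM; last exact: continuous_pole.
    by apply: cvgB => //; exact: cvg_cst.
  + exact: is_derive1_continuous (d1 t).
  + exact: is_derive1_continuous (is_derive_lnr t c b b0).
  + exact: c11.
  + by apply: cvgM; [exact: cvg_cst|exact: continuous_pole].
  + exact: is_derive1_continuous (d2 t).
  + exact: is_derive1_continuous (is_derive_atan_div t c b b0).
  + exact: c12.
- by move=> t /q0[-> _ -> _]; rewrite !mulr0 subrr.
- by move=> t /q0[-> -> -> ->]; rewrite /green_flux !mulr0 addr0 subrr.
Qed.

End Kernel.

(** * Domination of singular kernels in the plane *)

Section Plane.
Context {R : realType}.
Local Notation mu := (@lebesgue_measure R).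

(* Since [sqrt |a| * sqrt |b| <= |(a, b)|], the singular kernels are dominated by
   a product of integrable functions of one variable. *)
Lemma green_flux_bound (a b B Q q1 q11 q2 q12 : R) : a != 0 -> b != 0 ->
  `|a| <= B -> `|b| <= B ->
  `|q1| <= Q -> `|q11| <= Q -> `|q2| <= Q -> `|q12| <= Q ->
  `|green_flux a b q1 q11 q2 q12| <=
    (2 * B ^+ 2 + 2 * B + 3) * Q * ((Num.sqrt `|a|)^-1 * (Num.sqrt `|b|)^-1).
Proof.
move=> a0 b0 aB bB q1Q q11Q q2Q q12Q.
have na : 0 < `|a| by rewrite normr_gt0.
have nb : 0 < `|b| by rewrite normr_gt0.
have B0 : 0 <= B by rewrite (le_trans _ aB).
rewrite -invfM -sqrtrM//; set s := Num.sqrt (`|a| * `|b|).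
have s0 : 0 < s by rewrite sqrtr_gt0 mulr_gt0.
have sB : s <= B.
  by rewrite -(ger0_norm B0) -sqrtr_sqr ler_wsqrtr// expr2 ler_pM.
have q0 : 0 < a ^+ 2 + b ^+ 2 by exact: sqr_sum_gt0.
set r := Num.sqrt (a ^+ 2 + b ^+ 2).
have r2 : a ^+ 2 + b ^+ 2 = r ^+ 2 by rewrite sqr_sqrtr// ltW.
have r0 : 0 < r by rewrite sqrtr_gt0.
have sr : s <= r.
  rewrite ler_wsqrtr// -(real_normK (num_real a)) -(real_normK (num_real b)); nra.
have ar : `|a| <= r by rewrite -sqrtr_sqr ler_wsqrtr// lerDl sqr_ge0.
have br : `|b| <= r by rewrite -sqrtr_sqr ler_wsqrtr// lerDr sqr_ge0.
have rs : r^-1 <= s^-1 by rewrite lef_pV2.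
have kern c : `|c| <= r -> `|c / (a ^+ 2 + b ^+ 2)| <= s^-1.
  move=> cr; rewrite normrM normfV r2 normrX (gtr0_norm r0).
  apply: le_trans rs; rewrite expr2 invfM mulrA ler_pdivrMr// mulVf ?gt_eqF//.
  by rewrite ler_pdivrMr// mul1r.
have ln_bound : `|lnr a b| <= (2 * B ^+ 2 + 1) * s^-1.
  (* The inequality [ln z < z] is used at [r] and at [r^-1]. *)
  have h1 : `|lnr a b| <= r + r^-1.
    rewrite /lnr -/r ler_norml; apply/andP; split; last first.
      by rewrite (le_trans (ltW (ln_sublinear r0)))// lerDl invr_ge0 ltW.
    rewrite lerNl -lnV ?posrE// (le_trans (ltW (ln_sublinear _))) ?invr_gt0//.
    by rewrite lerDr ltW.
  apply: (le_trans h1).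
  have -> : r + r^-1 = (r ^+ 2 + 1) * r^-1 by field; rewrite gt_eqF.
  rewrite ler_pM ?invr_ge0 ?addr_ge0 ?sqr_ge0 ?(ltW r0)// lerD2r -r2.
  have : `|a| ^+ 2 <= B ^+ 2 by rewrite lerXn2r ?nnegrE.
  have : `|b| ^+ 2 <= B ^+ 2 by rewrite lerXn2r ?nnegrE.
  rewrite !real_normK ?num_real//; lra.
(* The arctangent is at most 2 in absolute value; the factor [B / s >= 1] only gives the bound the
   common form. *)
have atan_bound : `|atan (a / b)| <= 2 * B * s^-1.
  apply: (@le_trans _ _ 2).
    rewrite ler_norml; have := atan_gtNpi2 (a / b); have := atan_ltpi2 (a / b).
    have := @pihalf_lt2 R; move=> *; apply/andP; split; lra.
  by rewrite -mulrA ler_peMr// ler_pdivlMr// mul1r.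
have -> : (2 * B ^+ 2 + 2 * B + 3) * Q * s^-1 =
  s^-1 * Q + (2 * B ^+ 2 + 1) * s^-1 * Q + (s^-1 * Q + 2 * B * s^-1 * Q) by ring.
rewrite /green_flux (le_trans (ler_normB _ _))// lerD//.
  by rewrite (le_trans (ler_normD _ _))// lerD// normrM ler_pM// kern.
by rewrite (le_trans (ler_normD _ _))// lerD// normrM ler_pM// kern.
Qed.

(** The two lines through [(c, d)] form a null set [N]. Off [N] the function is dominated by a
    tensor product of one-variable weights, integrable by Tonelli. *)
Lemma integrable_dominated_rsqrt (f : R * R -> R) (c d B C : R) :
  measurable_fun setT f ->
  (forall y, y.1 != c -> y.2 != d ->
    `|f y| <= C * (rsqrt_weight c B y.1 * rsqrt_weight d B y.2)) ->
  (mu \x mu)%E.-integrable setT (EFin \o f).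
Proof.
move=> mf fb.
pose N : set (measurableTypeR R * measurableTypeR R) :=
  ([set c] `*` setT) `|` (setT `*` [set d]).
have boxE (A D : set R) : measurable A -> measurable D ->
    (mu \x mu)%E (A `*` D) = (mu A * mu D)%E.
  by move=> mA mD; exact: product_measure1E.
have N0 : (mu \x mu)%E.-negligible N.
  apply: negligibleU.
    exists ([set c] `*` setT); split => //; first exact: measurableX.
    by apply: etrans (boxE [set c] setT _ _) _ => //; rewrite lebesgue_measure_set1 mul0e.
  exists (setT `*` [set d]); split => //; first exact: measurableX.
  by apply: etrans (boxE setT [set d] _ _) _ => //; rewrite lebesgue_measure_set1 mule0.
pose W (y : R * R) := rsqrt_weight c B y.1 * rsqrt_weight d B y.2.
have mW : measurable_fun setT W.
  apply: measurable_funM.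
    by apply: (measurableT_comp (measurable_rsqrt_weight c B)); exact: measurable_fst.
  by apply: (measurableT_comp (measurable_rsqrt_weight d B)); exact: measurable_snd.
have iW : (mu \x mu)%E.-integrable setT (EFin \o W).
  apply/integrable12ltyP; first exact/measurable_EFinP.
  have /integrableP[_ i1] := integrable_rsqrt_weight c B.
  have /integrableP[_ i2] := integrable_rsqrt_weight d B.
  under eq_integral => x _.
    under eq_integral => y _ do rewrite /= /W/= normrM EFinM.
    rewrite ge0_integralZl//; last first.
      apply/measurable_EFinP; apply: (measurableT_comp (@normr_measurable R setT)).
      exact: measurable_rsqrt_weight.
    over.
  rewrite ge0_integralZr//=.
  - by rewrite lte_mul_pinfty// ?integral_ge0// ge0_fin_numE ?integral_ge0.
  - apply/measurable_EFinP; apply: (measurableT_comp (@normr_measurable R setT)).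
    exact: measurable_rsqrt_weight.
  - by move=> *; exact: integral_ge0.
have mN : measurable N by apply: measurableU; exact: measurableX.
have mEf : measurable_fun (setT : set (measurableTypeR R * measurableTypeR R))
  (EFin \o f) by exact/measurable_EFinP.
have mN0 : (mu \x mu)%E N = 0%E by exact: measure_negligible.
apply: (iffRL (@negligible_integrable _ _ _ (mu \x mu)%E _ _ (EFin \o f) mN
  measurableT mEf mN0)).
have mD : measurable
  ((setT : set (measurableTypeR R * measurableTypeR R)) `\` N) by exact: measurableD.
apply: (@le_integrable _ _ _ (mu \x mu)%E _ mD _ (fun y => C%:E * (EFin \o W) y)%E).
- by apply: measurable_funTS; exact/measurable_EFinP.
- move=> y [_ /= Ny]; rewrite /= lee_fin.
  apply: le_trans (ler_norm _); apply: fb.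
    by apply/eqP => h; apply: Ny; left.
  by apply/eqP => h; apply: Ny; right.
- apply: integrableZl => //.
  by apply: integrableS iW.
Qed.

End Plane.

(** * Integrability of the flux for compactly supported data *)

Section Green.
Context {R : realType}.
Local Notation mu := (@lebesgue_measure R).

(** A square rather than a disc suits slicing: the restrictions to all horizontal and vertical lines
    vanish beyond the same [M]. *)
Definition box_supported (M : R) (f : R * R -> R) :=
  forall y, M <= `|y.1| \/ M <= `|y.2| -> f y = 0.

Lemma box_supported_bounded (M : R) (f : R * R -> R) :
  continuous f -> box_supported M f -> exists Q, forall y, `|f y| <= Q.
Proof.
move=> cf f0.
have cK : compact (`[- M, M]%classic `*` `[- M, M]%classic : set (R * R)).
  by apply: compact_setX; exact: segment_compact.
have /compact_bounded[Q [_ HQ]] := continuous_compact (continuous_subspaceT cf) cK.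
exists (`|Q| + 1) => y.
have [My|yM] := leP M `|y.1|; first by rewrite f0 ?normr0 ?addr_ge0//; left.
have [My|yM'] := leP M `|y.2|; first by rewrite f0 ?normr0 ?addr_ge0//; right.
apply: HQ; first by rewrite (le_lt_trans (ler_norm _))// ltrDl.
by exists y => //; split; rewrite /= in_itv/= -ler_norml ltW.
Qed.

Lemma measurable_green_flux (a b q1 q11 q2 q12 : R * R -> R) :
  measurable_fun setT a -> measurable_fun setT b ->
  measurable_fun setT q1 -> measurable_fun setT q11 ->
  measurable_fun setT q2 -> measurable_fun setT q12 ->
  measurable_fun setT
    (fun y => green_flux (a y) (b y) (q1 y) (q11 y) (q2 y) (q12 y)).
Proof.
move=> ma mb m1 m11 m2 m12.
have mq : measurable_fun setT (fun y => a y ^+ 2 + b y ^+ 2).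
  by apply: measurable_funD; exact: measurable_funX.
have mp : measurable_fun setT (fun y => (a y ^+ 2 + b y ^+ 2)^-1).
  exact: (measurableT_comp measurable_inv).
have ml : measurable_fun setT (fun y => lnr (a y) (b y)).
  apply: (measurableT_comp (@measurable_ln R)).
  exact: (measurableT_comp measurable_sqrt).
have mt : measurable_fun setT (fun y => atan (a y / b y)).
  apply: (measurableT_comp measurable_atan); apply: measurable_funM => //.
  exact: (measurableT_comp measurable_inv).
apply: measurable_funB; apply: measurable_funD; apply: measurable_funM => //.
  exact: measurable_funM.
exact: measurable_funM.
Qed.

(** On the support, [y - x] stays in the square of half-side [B], where [green_flux_bound] dominates
    the flux. The four functions are independent here: setting three of them to zero isolates the
    arctangent or the logarithmic kernel. *)
Lemma integrable_green_flux (M : R) (x : R * R) (q1 q11 q2 q12 : R * R -> R) :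
  continuous q1 -> continuous q11 -> continuous q2 -> continuous q12 ->
  box_supported M q1 -> box_supported M q11 ->
  box_supported M q2 -> box_supported M q12 ->
  (mu \x mu)%E.-integrable setT (fun y : R * R =>
    (green_flux (y.1 - x.1) (y.2 - x.2) (q1 y) (q11 y) (q2 y) (q12 y))%:E) /\
  (mu \x mu)%E.-integrable setT (fun y : R * R =>
    (green_flux (y.2 - x.2) (y.1 - x.1) (q1 y) (q11 y) (q2 y) (q12 y))%:E).
Proof.
move=> c1 c11 c2 c12 s1 s11 s2 s12.
have [Q1 b1] := box_supported_bounded M _ c1 s1.
have [Q11 b11] := box_supported_bounded M _ c11 s11.
have [Q2 b2] := box_supported_bounded M _ c2 s2.
have [Q12 b12] := box_supported_bounded M _ c12 s12.
pose Q := `|Q1| + `|Q11| + `|Q2| + `|Q12|.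
pose B := `|M| + `|x.1| + `|x.2|.
have B0 : 0 <= B by rewrite !addr_ge0.
have Q0 : 0 <= Q by rewrite !addr_ge0.
have leQ (q : R) : [\/ q <= Q1, q <= Q11, q <= Q2 | q <= Q12] -> q <= Q.
  have := ler_norm Q1; have := ler_norm Q11; have := ler_norm Q2.
  have := ler_norm Q12; have := normr_ge0 Q1; have := normr_ge0 Q11.
  have := normr_ge0 Q2; have := normr_ge0 Q12.
  by rewrite /Q => ? ? ? ? ? ? ? ? []; lra.
have m1 : measurable_fun setT (fun y : R * R => y.1 - x.1).
  by apply: measurable_funB => //; exact: measurable_fst.
have m2 : measurable_fun setT (fun y : R * R => y.2 - x.2).
  by apply: measurable_funB => //; exact: measurable_snd.
have inside y : [\/ q1 y != 0, q11 y != 0, q2 y != 0 | q12 y != 0] ->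
    `|y.1 - x.1| <= B /\ `|y.2 - x.2| <= B.
  move=> hq; have [h1 h2] : `|y.1| < M /\ `|y.2| < M.
    have [h|h1] := leP M `|y.1|.
      by exfalso; case: hq; rewrite ?s1 ?s11 ?s2 ?s12 ?eqxx//; left.
    have [h|//] := leP M `|y.2|.
    by exfalso; case: hq; rewrite ?s1 ?s11 ?s2 ?s12 ?eqxx//; right.
  have := ler_norm M; have := normr_ge0 x.1; have := normr_ge0 x.2; rewrite /B => *.
  by split; apply: (le_trans (ler_normB _ _)); lra.
have out y : ~ (`|y.1 - x.1| <= B /\ `|y.2 - x.2| <= B) ->
    [/\ q1 y = 0, q11 y = 0, q2 y = 0 & q12 y = 0].
  move=> h; split; apply/eqP/negPn/negP => q0; apply: h; apply: inside.
  - exact: Or41.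
  - exact: Or42.
  - exact: Or43.
  - exact: Or44.
pose C := (2 * B ^+ 2 + 2 * B + 3) * Q.
have C0 : 0 <= C by rewrite mulr_ge0// !addr_ge0 ?mulr_ge0 ?sqr_ge0.
have Qb y : [/\ `|q1 y| <= Q, `|q11 y| <= Q, `|q2 y| <= Q & `|q12 y| <= Q].
  split; apply: leQ.
  - exact: Or41.
  - exact: Or42.
  - exact: Or43.
  - exact: Or44.
split.
- apply: (@integrable_dominated_rsqrt _ _ x.1 x.2 B C).
    by apply: (measurable_green_flux
      (fun y => y.1 - x.1) (fun y => y.2 - x.2)) => //;
      exact: continuous2_measurable.
  move=> y y1 y2; have [[B1 B2]|/out[-> -> -> ->]] :=
    pselect (`|y.1 - x.1| <= B /\ `|y.2 - x.2| <= B); last first.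
    rewrite /green_flux !mulr0 addr0 subrr normr0.
    by apply: mulr_ge0 => //; apply: mulr_ge0; exact: rsqrt_weight_ge0.
  have [? ? ? ?] := Qb y.
  by rewrite /rsqrt_weight B1 B2; apply: green_flux_bound; rewrite ?subr_eq0.
- apply: (@integrable_dominated_rsqrt _ _ x.1 x.2 B C).
    by apply: (measurable_green_flux
      (fun y => y.2 - x.2) (fun y => y.1 - x.1)) => //;
      exact: continuous2_measurable.
  move=> y y1 y2; have [[B1 B2]|/out[-> -> -> ->]] :=
    pselect (`|y.1 - x.1| <= B /\ `|y.2 - x.2| <= B); last first.
    rewrite /green_flux !mulr0 addr0 subrr normr0.
    by apply: mulr_ge0 => //; apply: mulr_ge0; exact: rsqrt_weight_ge0.
  have [? ? ? ?] := Qb y.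
  rewrite /rsqrt_weight B1 B2 (mulrC (Num.sqrt _)^-1).
  by apply: green_flux_bound; rewrite ?subr_eq0.
Qed.

End Green.

(** * The logarithmic potential inverts the Laplacian *)

Section Representation.
Context {R : realType}.
Local Notation mu := (@lebesgue_measure R).

Lemma continuous_slice1 (f : R * R -> R) (b : R) :
  continuous f -> continuous (fun s => f (s, b)).
Proof.
move=> cf s; apply: (continuous_comp (f := fun s : R => (s, b)) (g := f)); last exact: cf.
apply: (cvg_pair (F := nbhs s) (G := nbhs s) (H := nbhs b) (f := id) (g := fun=> b)) => //.
exact: cvg_cst.
Qed.

Lemma continuous_slice2 (f : R * R -> R) (a : R) :
  continuous f -> continuous (fun s => f (a, s)).
Proof.
move=> cf s; apply: (continuous_comp (f := fun s : R => (a, s)) (g := f)); last exact: cf.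
apply: (cvg_pair (F := nbhs s) (G := nbhs a) (H := nbhs s) (f := fun=> a) (g := id)) => //.
exact: cvg_cst.
Qed.

(** By Fubini the first variable is integrated first; the exceptional line [b = c], which passes
    through the pole in the application, is null. *)
Lemma integral_plane_null1 (F : R * R -> R) (c : R) :
  (mu \x mu)%E.-integrable setT (EFin \o F) ->
  (forall b, b != c -> (\int[mu]_s (F (s, b))%:E = 0)%E) ->
  (\int[(mu \x mu)%E]_y (F y)%:E = 0)%E.
Proof.
move=> iF F0; rewrite -[LHS](integral21_prod_meas1 iF).
rewrite (ae_eq_integral (cst 0%E)) ?integral0//.
  exact: (measurable_fubini_G iF).
exists [set c]; split => //; first exact: lebesgue_measure_set1.
move=> b /= bc; apply: contrapT => /eqP bc'; apply: bc => _.
exact: F0.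
Qed.

Lemma integral_plane_null2 (F : R * R -> R) (c : R) :
  (mu \x mu)%E.-integrable setT (EFin \o F) ->
  (forall a, a != c -> (\int[mu]_s (F (a, s))%:E = 0)%E) ->
  (\int[(mu \x mu)%E]_y (F y)%:E = 0)%E.
Proof.
move=> iF F0; rewrite -[LHS](integral12_prod_meas1 iF).
rewrite (ae_eq_integral (cst 0%E)) ?integral0//.
  exact: (measurable_fubini_F iF).
exists [set c]; split => //; first exact: lebesgue_measure_set1.
move=> a /= ac; apply: contrapT => /eqP ac'; apply: ac => _.
exact: F0.
Qed.

Section formula.
Variables (psi p1 p2 p11 p12 p22 : R * R -> R) (M : R) (x : R * R).
Hypotheses (cpsi : continuous psi) (c1 : continuous p1) (c2 : continuous p2)
  (c11 : continuous p11) (c12 : continuous p12) (c22 : continuous p22).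
Hypotheses (spsi : box_supported M psi) (s1 : box_supported M p1)
  (s2 : box_supported M p2) (s11 : box_supported M p11)
  (s12 : box_supported M p12) (s22 : box_supported M p22).
Hypothesis d2 : forall a b : R, is_derive b (1 : R) (fun s => psi (a, s)) (p2 (a, b)).
Hypothesis d11 : forall a b : R, is_derive a (1 : R) (fun s => p1 (s, b)) (p11 (a, b)).
Hypothesis d21 : forall a b : R, is_derive a (1 : R) (fun s => p2 (s, b)) (p12 (a, b)).
Hypothesis d12 : forall a b : R, is_derive b (1 : R) (fun s => p1 (a, s)) (p12 (a, b)).
Hypothesis d22 : forall a b : R, is_derive b (1 : R) (fun s => p2 (a, s)) (p22 (a, b)).

(* [F] is the derivative of [ln |y - x| * p1 - atan (a / b) * p2] in the first
   variable and [G] that of [ln |y - x| * p2 - atan (b / a) * p1] in the second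
   one, with [(a, b) = y - x].  As [atan (a / b) + atan (b / a)] is
   [pi / 2 * sgn (a * b)], [F + G + S] is [ln |y - x| * (p11 + p22)]. *)
Let F y := green_flux (y.1 - x.1) (y.2 - x.2) (p1 y) (p11 y) (p2 y) (p12 y).
Let G y := green_flux (y.2 - x.2) (y.1 - x.1) (p2 y) (p22 y) (p1 y) (p12 y).
Let S y := Num.sg (y.1 - x.1) * (pi / 2 * Num.sg (y.2 - x.2) * p12 y).

Let iF : (mu \x mu)%E.-integrable setT (EFin \o F).
Proof. by apply: (integrable_green_flux M x p1 p11 p2 p12 _ _ _ _ _ _ _ _).1. Qed.

Let iG : (mu \x mu)%E.-integrable setT (EFin \o G).
Proof. by apply: (integrable_green_flux M x p2 p22 p1 p12 _ _ _ _ _ _ _ _).2. Qed.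

Let integral_F : (\int[(mu \x mu)%E]_y (F y)%:E = 0)%E.
Proof.
apply: (integral_plane_null1 F x.2 iF) => b b0.
apply: (integral_green_flux_slice (fun s => p1 (s, b)) (fun s => p11 (s, b))
  (fun s => p2 (s, b)) (fun s => p12 (s, b)) x.1 (b - x.2) M).
- by rewrite subr_eq0.
- exact: continuous_slice1.
- exact: continuous_slice1.
- by move=> t Mt; split; [apply: s1|apply: s11|apply: s2|apply: s12]; left.
Qed.

Let integral_G : (\int[(mu \x mu)%E]_y (G y)%:E = 0)%E.
Proof.
apply: (integral_plane_null2 G x.1 iG) => a a0.
apply: (integral_green_flux_slice (fun s => p2 (a, s)) (fun s => p22 (a, s))
  (fun s => p1 (a, s)) (fun s => p12 (a, s)) x.2 (a - x.1) M).
- by rewrite subr_eq0.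
- exact: continuous_slice2.
- exact: continuous_slice2.
- by move=> t Mt; split; [apply: s2|apply: s22|apply: s1|apply: s12]; right.
Qed.

Let c0 : continuous (fun _ : R * R => 0 : R).
Proof. by move=> y; exact: cvg_cst. Qed.

(** With only the slot [q12] filled, the two fluxes add up to the two arctangents, which [atanD_inv]
    turns into a sign. Integrability of [S] thus follows from that of the fluxes. *)
Let SE y : S y = - (green_flux (y.1 - x.1) (y.2 - x.2) 0 0 0 (p12 y) +
                  green_flux (y.2 - x.2) (y.1 - x.1) 0 0 0 (p12 y)).
Proof.
rewrite /S /green_flux !mulr0 !add0r opprD !opprK -mulrDl.
rewrite -[(y.2 - x.2) / _]invf_div atanD_inv sgrM sgrV; ring.
Qed.

Let iS : (mu \x mu)%E.-integrable setT (EFin \o S).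
Proof.
have z : box_supported M (fun=> 0 : R) by [].
have [i1 i2] := integrable_green_flux M x _ _ _ _ c0 c0 c0 c12 z z z s12.
rewrite (_ : EFin \o S = -%E \o
  ((fun y => (green_flux (y.1 - x.1) (y.2 - x.2) 0 0 0 (p12 y))%:E) \+
   (fun y => (green_flux (y.2 - x.2) (y.1 - x.1) 0 0 0 (p12 y))%:E))%E); last first.
  by apply/funext => y /=; rewrite SE.
by apply: integrableN; apply: integrableD.
Qed.

(** Integrating a derivative against a sign evaluates the primitive at the jump: the first
    integration turns [p12] into [p2] on the vertical line through [x], the second turns [p2] into
    [psi x]. *)
Let integral_S : (\int[(mu \x mu)%E]_y (S y)%:E = (2 * pi * psi x)%:E)%E.
Proof.
rewrite -[LHS](integral21_prod_meas1 iS).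
transitivity (\int[mu]_b (Num.sg (b - x.2) * (- pi * p2 (x.1, b)))%:E)%E.
  apply: eq_integral => b _; rewrite /fubini_G /S /=.
  rewrite (@integral_sgr_derive_support _
    (fun a => pi / 2 * Num.sg (b - x.2) * p2 (a, b)) _ M).
  - by congr EFin; field.
  - by move=> a; apply: cvgM; [exact: cvg_cst|exact: continuous_slice1].
  - by move=> a Ma; rewrite s2 ?mulr0//; left.
  - by move=> a Ma; rewrite s12 ?mulr0//; left.
rewrite (@integral_sgr_derive_support _ (fun b => - pi * psi (x.1, b)) _ M).
- by congr EFin; case: x => ? ? /=; ring.
- by move=> b; apply: cvgM; [exact: cvg_cst|exact: continuous_slice2].
- by move=> b Mb; rewrite spsi ?mulr0//; right.
- by move=> b Mb; rewrite s2 ?mulr0//; right.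
Qed.

Lemma integral_log_laplacian :
  (\int[(mu \x mu)%E]_y (lnr (y.1 - x.1) (y.2 - x.2) * (p11 y + p22 y))%:E
   = (2 * pi * psi x)%:E)%E.
Proof.
(* The null integrals of [F] and [G] are added to that of [S], which reduces the claim to a
   pointwise identity. *)
rewrite -integral_S -[RHS]add0e -integral_F -[X in (X + _)%E]adde0 -integral_G.
rewrite -integralD// -integralD//; last exact: integrableD.
apply: eq_integral => y _; rewrite -!EFinD SE /F /G /green_flux; congr EFin.
have -> : lnr (y.2 - x.2) (y.1 - x.1) = lnr (y.1 - x.1) (y.2 - x.2).
  by rewrite /lnr addrC.
rewrite (addrC (_ ^+ 2)); ring.
Qed.

End formula.
End Representation.

(** * Partial derivatives as slice derivatives; the potential of a Laplacian *)

Section Potential.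
Context {R : realType}.
Implicit Types f psi : R * R -> R.
Local Notation mu := (@lebesgue_measure R).

Let quot1E f (x : R * R) :
  (fun h : R => h^-1 *: (f (h *: e1 R + x) - f x)) =
  (fun h : R => h^-1 *: (f (h *: (1 : R) + x.1, x.2) - f (x.1, x.2))).
Proof.
apply/funext => h; case: x => a b; congr (_ *: (f (_, _) - _)).
by rewrite /= /GRing.scale/= mulr0 add0r.
Qed.

Let quot2E f (x : R * R) :
  (fun h : R => h^-1 *: (f (h *: e2 R + x) - f x)) =
  (fun h : R => h^-1 *: (f (x.1, h *: (1 : R) + x.2) - f (x.1, x.2))).
Proof.
apply/funext => h; case: x => a b; congr (_ *: (f (_, _) - _)).
by rewrite /= /GRing.scale/= mulr0 add0r.
Qed.

Lemma is_derive_e1E f (x : R * R) (d : R) :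
  is_derive x (e1 R) f d <-> is_derive x.1 (1 : R) (fun s => f (s, x.2)) d.
Proof.
split => -[].
  rewrite /derivable /derive quot1E => h1 h2; exact: DeriveDef.
rewrite /derivable /derive -(quot1E f x) => h1 h2; exact: DeriveDef.
Qed.

Lemma is_derive_e2E f (x : R * R) (d : R) :
  is_derive x (e2 R) f d <-> is_derive x.2 (1 : R) (fun s => f (x.1, s)) d.
Proof.
split => -[].
  rewrite /derivable /derive quot2E => h1 h2; exact: DeriveDef.
rewrite /derivable /derive -(quot2E f x) => h1 h2; exact: DeriveDef.
Qed.

Lemma has_partials_slice1 f : has_partials f -> forall a b : R,
  is_derive a (1 : R) (fun s => f (s, b)) (partial1 f (a, b)).
Proof.
move=> hf a b; apply/(is_derive_e1E f (a, b)).
by apply/derivableP; case: (hf (a, b)).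
Qed.

Lemma has_partials_slice2 f : has_partials f -> forall a b : R,
  is_derive b (1 : R) (fun s => f (a, s)) (partial2 f (a, b)).
Proof.
move=> hf a b; apply/(is_derive_e2E f (a, b)).
by apply/derivableP; case: (hf (a, b)).
Qed.

Lemma box_supportedW (M N : R) f : M <= N -> box_supported M f -> box_supported N f.
Proof. by move=> MN sf y [] /(le_trans MN) h; apply: sf; [left|right]. Qed.

(** The margin 1 leaves around each point concerned a sup-norm ball on which [f] vanishes. *)
Lemma box_supported_derive (M : R) f (v : R * R) :
  box_supported M f -> box_supported (M + 1) (fun x => 'D_v f x).
Proof.
move=> sf y hy; rewrite -(derive_cst (0 : R) y v); apply: near_eq_derive.
apply/nbhs_ballP; exists 1 => //= z [z1 z2]; apply: sf.
case: hy => hy; [left|right].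
  have := ler_normD (y.1 - z.1) z.1; rewrite subrK; move: z1; rewrite /ball/=; lra.
have := ler_normD (y.2 - z.2) z.2; rewrite subrK; move: z2; rewrite /ball/=; lra.
Qed.

(** This is [integral_log_laplacian] for [psi], the box being enlarged by 1 for each of the two
    derivatives; the kernel's factor [- (2 * pi)^-1] compensates the minus sign and the constant
    [2 * pi]. *)
Lemma inv_neg_laplacianK (M : R) psi : Ck 2 psi -> box_supported M psi ->
  partial1 (partial2 psi) = partial2 (partial1 psi) ->
  inv_neg_laplacian
    (fun x => - (partial1 (partial1 psi) x + partial2 (partial2 psi) x)) = psi.
Proof.
move=> [h0 [[h1 [c11 [c12 c1]]] [[h2 [c21 [c22 c2]]] cpsi]]] spsi schwarz.
have s1 := box_supported_derive _ _ (e1 R) spsi.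
have s2 := box_supported_derive _ _ (e2 R) spsi.
have s11 := box_supported_derive _ _ (e1 R) s1.
have s12 := box_supported_derive _ _ (e2 R) s1.
have s22 := box_supported_derive _ _ (e2 R) s2.
have M1 : M <= M + 1 + 1 by lra.
have M2 : M + 1 <= M + 1 + 1 by lra.
apply/funext => x.
have key := @integral_log_laplacian R psi (partial1 psi) (partial2 psi)
  (partial1 (partial1 psi)) (partial2 (partial1 psi)) (partial2 (partial2 psi))
  (M + 1 + 1) x c1 c2 c11 c12 c22 (box_supportedW _ _ _ M1 spsi)
  (box_supportedW _ _ _ M2 s1) (box_supportedW _ _ _ M2 s2) s11 s12 s22
  (has_partials_slice2 _ h0) (has_partials_slice1 _ h1) _
  (has_partials_slice2 _ h1) (has_partials_slice2 _ h2).
(* The formula uses one function for both mixed derivatives; [schwarz] identifies them. *)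
have {}key := key (eq_ind _ (fun g => forall a b : R, is_derive a (1 : R)
  (fun s => partial2 psi (s, b)) (g (a, b))) (has_partials_slice1 _ h2) _ schwarz).
have z : box_supported (M + 1 + 1) (fun=> 0 : R) by [].
have c0 : continuous (fun _ : R * R => 0 : R) by move=> y; exact: cvg_cst.
pose lap y := partial1 (partial1 psi) y + partial2 (partial2 psi) y.
have clap : continuous lap by move=> y; apply: cvgD; [exact: c11|exact: c22].
have slap : box_supported (M + 1 + 1) lap.
  move=> y hy; apply: etrans (congr2 +%R (s11 y hy) (s22 y hy)) _.
  by rewrite addr0.
(* With [lap] in the slot [q11] and zeros elsewhere, the flux is the logarithmic integrand. *)
have [+ _] := integrable_green_flux _ x _ _ _ _ c0 clap c0 c0 z slap z z.
rewrite /green_flux.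
under eq_fun do rewrite !mulr0 addr0 subr0 add0r.
move=> ilap.
rewrite /inv_neg_laplacian /Rintegral.
have -> : (fun y : R * R => (- (2 * pi)^-1 * ln (enorm (x - y)) *
    (- (partial1 (partial1 psi) y + partial2 (partial2 psi) y)))%:E) =
  (fun y : R * R => ((2 * pi)^-1 * (lnr (y.1 - x.1) (y.2 - x.2) * lap y))%:E).
  apply/funext => y; congr EFin.
  rewrite /lnr /enorm /= -(sqrrN (y.1 - _)) -(sqrrN (y.2 - _)) !opprB.
  by rewrite !mulNr mulrN opprK mulrA.
under eq_integral do rewrite EFinM.
rewrite (integralZl measurableT ilap).
have pi0 := @pi_gt0 R.
have pi2 : 2 * pi != 0 :> R by apply: lt0r_neq0; rewrite mulr_gt0.
by rewrite key -EFinM /= mulrA (mulVf pi2) mul1r.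
Qed.

End Potential.

(** * Functions of class C^k and truncated paraboloids *)

Section Calculus.
Context {R : realType}.
Implicit Types f g : R * R -> R.

Lemma Ck_continuous k f : Ck k f -> continuous f.
Proof. by case: k => [//|k [_ [_ [_]]]]. Qed.

Lemma CkW k f : Ck k.+1 f -> Ck k f.
Proof.
elim: k f => [|k IH] f; first exact: Ck_continuous.
move=> [hf [f1 [f2 cf]]]; split; first exact: hf.
by split; [exact: IH|split; [exact: IH|exact: cf]].
Qed.

Lemma partial1E f x d : is_derive x (e1 R) f d -> partial1 f x = d.
Proof. by case. Qed.

Lemma partial2E f x d : is_derive x (e2 R) f d -> partial2 f x = d.
Proof. by case. Qed.

Lemma Ck_cst k (c : R) : Ck k (fun=> c).
Proof.
elim: k c => [|k IH] c; first by move=> x; exact: cvg_cst.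
have -> : Ck k.+1 (fun=> c) = (has_partials (fun=> c) /\ Ck k (partial1 (fun=> c))
  /\ Ck k (partial2 (fun=> c)) /\ continuous (fun _ : R * R => c)) by [].
have -> : partial1 (fun=> c) = fun=> 0 by apply/funext => x; exact: derive_cst.
have -> : partial2 (fun=> c) = fun=> 0 by apply/funext => x; exact: derive_cst.
split; first by move=> x; split; exact: derivable_cst.
by do 2![split; first exact: IH]; move=> x; exact: cvg_cst.
Qed.

Lemma CkD k f g : Ck k f -> Ck k g -> Ck k (fun x => f x + g x).
Proof.
elim: k f g => [|k IH] f g.
  by move=> cf cg x; apply: cvgD; [exact: cf|exact: cg].
move=> [hf [f1 [f2 cf]]] [hg [g1 [g2 cg]]].
split.
  by move=> x; case: (hf x) => ? ?; case: (hg x) => ? ?; split; exact: (@derivableD _ _ _ f g).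
have -> : partial1 (fun x => f x + g x) = fun x => partial1 f x + partial1 g x.
  by apply/funext => x; case: (hf x) => ? ?; case: (hg x) => ? ?; exact: (@deriveD _ _ _ f g).
have -> : partial2 (fun x => f x + g x) = fun x => partial2 f x + partial2 g x.
  by apply/funext => x; case: (hf x) => ? ?; case: (hg x) => ? ?; exact: (@deriveD _ _ _ f g).
by do 2![split; first exact: IH]; move=> x; apply: cvgD; [exact: cf|exact: cg].
Qed.

Lemma CkM k f g : Ck k f -> Ck k g -> Ck k (fun x => f x * g x).
Proof.
elim: k f g => [|k IH] f g.
  by move=> cf cg x; apply: cvgM; [exact: cf|exact: cg].
move=> Cf Cg; have [kf kg] := (CkW _ _ Cf, CkW _ _ Cg).
move: Cf Cg => [hf [f1 [f2 cf]]] [hg [g1 [g2 cg]]].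
have d1 x := (hf x).1; have d2 x := (hf x).2.
have d3 x := (hg x).1; have d4 x := (hg x).2.
split.
  by move=> x; split;
    [have := derivableM (d1 x) (d3 x)|have := derivableM (d2 x) (d4 x)].
have -> : partial1 (fun x => f x * g x) =
    fun x => f x * partial1 g x + g x * partial1 f x.
  by apply/funext => x; have := deriveM (d1 x) (d3 x).
have -> : partial2 (fun x => f x * g x) =
    fun x => f x * partial2 g x + g x * partial2 f x.
  by apply/funext => x; have := deriveM (d2 x) (d4 x).
do 2![split; first by apply: CkD; exact: IH].
by move=> x; apply: cvgM; [exact: cf|exact: cg].
Qed.

Lemma Ck_sum k (I : Type) (s : seq I) (F : I -> R * R -> R) :
  (forall i, Ck k (F i)) -> Ck k (fun x => \sum_(i <- s) F i x).
Proof.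
move=> CF; elim: s => [|i s IH].
  by under eq_fun do rewrite big_nil; exact: Ck_cst.
by under eq_fun do rewrite big_cons; exact: CkD.
Qed.

Lemma Ck_fst k : Ck k (@fst R R).
Proof.
case: k => [|k]; first by move=> x; exact: cvg_fst.
have d1 x : is_derive x (e1 R) (@fst R R) (1 : R).
  by apply/is_derive_e1E; exact: is_derive_id.
have d2 x : is_derive x (e2 R) (@fst R R) (0 : R).
  by apply/is_derive_e2E; exact: is_derive_cst.
split; first by move=> x; split; apply: ex_derive.
have -> : partial1 (@fst R R) = fun=> 1 by apply/funext => x; exact: partial1E.
have -> : partial2 (@fst R R) = fun=> 0 by apply/funext => x; exact: partial2E.
by do 2![split; first exact: Ck_cst]; move=> x; exact: cvg_fst.
Qed.

Lemma Ck_snd k : Ck k (@snd R R).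
Proof.
case: k => [|k]; first by move=> x; exact: cvg_snd.
have d1 x : is_derive x (e1 R) (@snd R R) (0 : R).
  by apply/is_derive_e1E; exact: is_derive_cst.
have d2 x : is_derive x (e2 R) (@snd R R) (1 : R).
  by apply/is_derive_e2E; exact: is_derive_id.
split; first by move=> x; split; apply: ex_derive.
have -> : partial1 (@snd R R) = fun=> 0 by apply/funext => x; exact: partial1E.
have -> : partial2 (@snd R R) = fun=> 1 by apply/funext => x; exact: partial2E.
by do 2![split; first exact: Ck_cst]; move=> x; exact: cvg_snd.
Qed.

Lemma is_derive_bigsum (V : normedModType R) (I : Type) (s : seq I)
    (F : I -> V -> R) (dF : I -> R) (x v : V) :
  (forall i, is_derive x v (F i) (dF i)) ->
  is_derive x v (fun y => \sum_(i <- s) F i y) (\sum_(i <- s) dF i).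
Proof.
move=> h; elim: s => [|i s IH].
  rewrite big_nil; under eq_fun do rewrite big_nil.
  exact: is_derive_cst.
rewrite big_cons; under eq_fun do rewrite big_cons.
exact: is_deriveD.
Qed.

(** At [n = 0] this is the constant 1, since [0 ^+ 0 = 1]; it vanishes for [s <= 0] only from
    [n = 1] on. *)
Definition posX (n : nat) (s : R) : R := Num.max s 0 ^+ n.

Lemma continuous_posX n : continuous (posX n).
Proof.
move=> s; apply: (continuous_comp (f := fun s : R => Num.max s 0) (g := fun s => s ^+ n));
  last exact: exprn_continuous.
by apply: (@continuous_max R R id (cst 0)) => //; exact: cvg_cst.
Qed.

Lemma posX_le0 n s : s <= 0 -> posX n.+1 s = 0.
Proof. by move=> s0; rewrite /posX max_r// expr0n. Qed.

Lemma posX_ge0 n s : 0 <= s -> posX n s = s ^+ n.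
Proof. by move=> s0; rewrite /posX max_l. Qed.

Lemma posXS n s : posX n.+2 s = s * posX n.+1 s.
Proof.
have [s0|s0] := leP s 0; first by rewrite !posX_le0// mulr0.
by rewrite !posX_ge0 ?ltW// exprS.
Qed.

(** Only [s = 0] is delicate: by [posXS], [posX n.+1] is there the slope function of Caratheodory's
    criterion, continuous with value 0. *)
Lemma is_derive_posX n (s : R) :
  is_derive s (1 : R) (posX n.+2) (n.+2%:R * posX n.+1 s).
Proof.
have [s0|s0|->] := ltgtP s 0.
- rewrite posX_le0 ?ltW// mulr0.
  apply: (@near_eq_is_derive _ _ _ (cst 0) (posX n.+2)).
  by apply: filterS (lt_nbhsl s0) => t t0; rewrite posX_le0// ltW.
- rewrite posX_ge0 ?ltW//.
  have H : is_derive s (1 : R) (fun t : R => t ^+ n.+2) (n.+2%:R * s ^+ n.+1).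
    have H := @is_deriveX R R id n.+2 s (1 : R) (1 : R) (is_derive_id s (1 : R)).
    by rewrite exprfctE in H; apply: is_derive_eq; rewrite /GRing.scale/= mulr1.
  apply: (@near_eq_is_derive _ _ _ _ _ _ _ _ _ H).
  apply/nbhs_ballP; exists s => //= t; rewrite /ball /= ltr_norml => /andP[_ h].
  by rewrite posX_ge0//; lra.
- rewrite posX_le0// mulr0; apply/is_derive1_caratheodory.
  exists (posX n.+1); split.
  + by move=> z; rewrite posXS (posX_le0 n.+1)// !subr0 mulrC.
  + exact: continuous_posX.
  + by rewrite posX_le0.
Qed.

(** [A] is a squared radius: the depth is positive exactly in the open disc of radius [sqrt A]
    around [c]. *)
Definition depth (A : R) (c x : R * R) : R :=
  A - ((x.1 - c.1) ^+ 2 + (x.2 - c.2) ^+ 2).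

Definition cap (n : nat) (A : R) (c x : R * R) : R := posX n (depth A c x).

Lemma is_derive_paraboloid (A c1 b a : R) :
  is_derive a (1 : R) (fun s => A - ((s - c1) ^+ 2 + b)) (- (2 * (a - c1))).
Proof. by apply: is_derive_eq; rewrite /GRing.scale/=; ring. Qed.

Lemma is_derive_cap1 n A c x :
  is_derive x (e1 R) (cap n.+2 A c)
    (- (2 * n.+2%:R) * (x.1 - c.1) * cap n.+1 A c x).
Proof.
apply/is_derive_e1E.
have H : is_derive x.1 (1 : R) (fun s => depth A c (s, x.2)) (- (2 * (x.1 - c.1))).
  exact: (is_derive_paraboloid A c.1 ((x.2 - c.2) ^+ 2) x.1).
apply: is_derive_eq (is_derive1_comp_fun _ _ _ _ _ (is_derive_posX n _) H) _.
by rewrite /cap; case: x H => a b _ /=; ring.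
Qed.

Lemma is_derive_cap2 n A c x :
  is_derive x (e2 R) (cap n.+2 A c)
    (- (2 * n.+2%:R) * (x.2 - c.2) * cap n.+1 A c x).
Proof.
apply/is_derive_e2E.
have H : is_derive x.2 (1 : R) (fun s => depth A c (x.1, s)) (- (2 * (x.2 - c.2))).
  have -> : (fun s => depth A c (x.1, s)) =
      (fun s => A - ((s - c.2) ^+ 2 + (x.1 - c.1) ^+ 2)).
    by apply/funext => s; congr (_ - _); rewrite addrC.
  exact: is_derive_paraboloid.
apply: is_derive_eq (is_derive1_comp_fun _ _ _ _ _ (is_derive_posX n _) H) _.
by rewrite /cap; case: x H => a b _ /=; ring.
Qed.

(** Each differentiation lowers the exponent of a cap by one and brings out an affine factor, hence
    an induction on [k]. *)
Lemma Ck_cap k A c : Ck k (cap k.+1 A c).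
Proof.
have C2 j : Ck j (fun x : R * R => (x.2 - c.2)).
  by apply: CkD; [exact: Ck_snd|exact: Ck_cst].
have C1 j : Ck j (fun x : R * R => (x.1 - c.1)).
  by apply: CkD; [exact: Ck_fst|exact: Ck_cst].
have Cd j : Ck j (depth A c).
  have -> : depth A c = fun x =>
      A + -1 * ((x.1 - c.1) * (x.1 - c.1) + (x.2 - c.2) * (x.2 - c.2)).
    by apply/funext => x; rewrite /depth; ring.
  apply: CkD; first exact: Ck_cst.
  by apply: CkM; [exact: Ck_cst|apply: CkD; exact: CkM].
have cb n : continuous (cap n A c).
  move=> x; apply: (continuous_comp (f := depth A c) (g := posX n)).
    exact: (Ck_continuous _ _ (Cd 0%N)).
  exact: continuous_posX.
elim: k => [|k IH]; first exact: cb.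
split.
  by move=> x; split; apply: ex_derive;
    [exact: is_derive_cap1|exact: is_derive_cap2].
split; last split; last exact: cb.
  have -> : partial1 (cap k.+2 A c) =
    fun x => - (2 * k.+2%:R) * (x.1 - c.1) * cap k.+1 A c x.
    by apply/funext => x; apply: partial1E; exact: is_derive_cap1.
  by apply: CkM => //; apply: CkM => //; exact: Ck_cst.
have -> : partial2 (cap k.+2 A c) =
    fun x => - (2 * k.+2%:R) * (x.2 - c.2) * cap k.+1 A c x.
  by apply/funext => x; apply: partial2E; exact: is_derive_cap2.
by apply: CkM => //; apply: CkM => //; exact: Ck_cst.
Qed.

Lemma box_supported_cap n A c (M : R) : `|A| + `|c.1| + `|c.2| + 1 <= M ->
  box_supported M (cap n.+1 A c).
Proof.
move=> AM y hy; apply: posX_le0; rewrite /depth subr_le0.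
(* The box is measured by a radius, and [|A| + 1] dominates the square root of [A]. *)
have A1 : A <= (`|A| + 1) ^+ 2.
  by have := ler_norm A; have := normr_ge0 A; nra.
apply: (le_trans A1); have [n1 n2] := (normr_ge0 c.1, normr_ge0 c.2).
have := normr_ge0 A.
case: hy => hy An.
  rewrite ler_wpDr ?sqr_ge0// -(real_normK (num_real (y.1 - c.1))).
  rewrite lerXn2r ?nnegrE ?addr_ge0//.
  have := ler_normD (y.1 - c.1) c.1; rewrite subrK; lra.
rewrite ler_wpDl ?sqr_ge0// -(real_normK (num_real (y.2 - c.2))).
rewrite lerXn2r ?nnegrE ?addr_ge0//.
have := ler_normD (y.2 - c.2) c.2; rewrite subrK; lra.
Qed.

End Calculus.

(** * Stream function and vorticity of finitely many discs *)

Section Discs.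
Context {R : realType}.

Lemma box_supported_sum (I : Type) (s : seq I) (F : I -> R * R -> R) :
  (forall i, exists M, box_supported M (F i)) ->
  exists M, box_supported M (fun x => \sum_(i <- s) F i x).
Proof.
move=> hF; elim: s => [|i s [M IH]]; first by exists 0 => y _; rewrite big_nil.
have [N hN] := hF i; exists (Num.max M N) => y hy; rewrite big_cons.
rewrite (box_supportedW _ _ _ _ hN y hy) ?le_max ?lexx ?orbT//.
by rewrite (box_supportedW _ _ _ _ IH y hy) ?le_max ?lexx ?orbT// addr0.
Qed.

Lemma box_supported_compact (M : R) (f : R * R -> R) :
  box_supported M f -> compactly_supported f.
Proof.
move=> sf; pose K : set (R * R) := `[- M, M]%classic `*` `[- M, M]%classic.
have cK : compact K by apply: compact_setX; exact: segment_compact.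
apply: (subclosed_compact _ cK); first exact: closed_closure.
have clK : closed K.
  by apply: compact_closed => //; exact: norm_hausdorff.
rewrite [X in _ `<=` X](iffLR (closure_id K) clK); apply: closure_subset => y /= fy.
have [My|yM] := leP M `|y.1|; first by move: fy; rewrite sf ?eqxx//; left.
have [My|yM'] := leP M `|y.2|; first by move: fy; rewrite sf ?eqxx//; right.
by split; rewrite /= in_itv/= -ler_norml ltW.
Qed.

(** Such moments are, up to a constant, the first derivatives of caps; this lemma and the next three
    give all second derivatives of [stream]. *)
Lemma is_derive_moment11 n A (c x : R * R) :
  is_derive x (e1 R) (fun y => (y.1 - c.1) * cap n.+2 A c y)
    (cap n.+2 A c x +
     (x.1 - c.1) * (- (2 * n.+2%:R) * (x.1 - c.1) * cap n.+1 A c x)).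
Proof.
have /is_derive_e1E H := is_derive_cap1 n A c x; apply/is_derive_e1E.
apply: is_derive_eq; rewrite /GRing.scale/=; case: x H => a b _ /=; ring.
Qed.

Lemma is_derive_moment22 n A (c x : R * R) :
  is_derive x (e2 R) (fun y => (y.2 - c.2) * cap n.+2 A c y)
    (cap n.+2 A c x +
     (x.2 - c.2) * (- (2 * n.+2%:R) * (x.2 - c.2) * cap n.+1 A c x)).
Proof.
have /is_derive_e2E H := is_derive_cap2 n A c x; apply/is_derive_e2E.
apply: is_derive_eq; rewrite /GRing.scale/=; case: x H => a b _ /=; ring.
Qed.

Lemma is_derive_moment12 n A (c x : R * R) :
  is_derive x (e2 R) (fun y => (y.1 - c.1) * cap n.+2 A c y)
    ((x.1 - c.1) * (- (2 * n.+2%:R) * (x.2 - c.2) * cap n.+1 A c x)).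
Proof.
have /is_derive_e2E H := is_derive_cap2 n A c x; apply/is_derive_e2E.
apply: is_derive_eq (is_deriveZ (x.1 - c.1) H) _.
by rewrite /GRing.scale/=; case: x H => a b _ /=; ring.
Qed.

Lemma is_derive_moment21 n A (c x : R * R) :
  is_derive x (e1 R) (fun y => (y.2 - c.2) * cap n.+2 A c y)
    ((x.2 - c.2) * (- (2 * n.+2%:R) * (x.1 - c.1) * cap n.+1 A c x)).
Proof.
have /is_derive_e1E H := is_derive_cap1 n A c x; apply/is_derive_e1E.
apply: is_derive_eq (is_deriveZ (x.2 - c.2) H) _.
by rewrite /GRing.scale/=; case: x H => a b _ /=; ring.
Qed.

(* [(k, A, c)] stands for [k] times the cap of squared radius [A] centered
   at [c]. *)
Definition disc : Type := (R * R * (R * R))%type.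
Implicit Types (s : seq disc) (i : disc) (x : R * R).

Definition stream s x : R := \sum_(i <- s) i.1.1 * cap 5 i.1.2 i.2 x.

(** Minus the Laplacian of [stream]. With [r^2 = A - depth], the Laplacian
    [-20 * cap 4 + 80 * r^2 * cap 3] of [cap 5] equals [-100 * cap 4 + 80 * A * cap 3]. *)
Definition vorticity s x : R := \sum_(i <- s)
  i.1.1 * (100 * cap 4 i.1.2 i.2 x - 80 * i.1.2 * cap 3 i.1.2 i.2 x).

Lemma is_derive_stream1 s x : is_derive x (e1 R) (stream s)
  (\sum_(i <- s) (-10 * i.1.1) * ((x.1 - i.2.1) * cap 4 i.1.2 i.2 x)).
Proof.
apply: is_derive_bigsum => i.
apply: is_derive_eq (is_deriveZ i.1.1 (is_derive_cap1 3 i.1.2 i.2 x)) _.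
rewrite /GRing.scale/=; ring.
Qed.

Lemma is_derive_stream2 s x : is_derive x (e2 R) (stream s)
  (\sum_(i <- s) (-10 * i.1.1) * ((x.2 - i.2.2) * cap 4 i.1.2 i.2 x)).
Proof.
apply: is_derive_bigsum => i.
apply: is_derive_eq (is_deriveZ i.1.1 (is_derive_cap2 3 i.1.2 i.2 x)) _.
rewrite /GRing.scale/=; ring.
Qed.

Lemma is_derive_vorticity1 s x : is_derive x (e1 R) (vorticity s)
  (\sum_(i <- s) i.1.1 * ((x.1 - i.2.1) *
     (480 * i.1.2 * cap 2 i.1.2 i.2 x - 800 * cap 3 i.1.2 i.2 x))).
Proof.
apply: is_derive_bigsum => i.
apply: is_derive_eq (is_deriveZ i.1.1 (is_deriveB
  (is_deriveZ 100 (is_derive_cap1 2 i.1.2 i.2 x))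
  (is_deriveZ (80 * i.1.2) (is_derive_cap1 1 i.1.2 i.2 x)))) _.
rewrite /GRing.scale/=; ring.
Qed.

Lemma is_derive_vorticity2 s x : is_derive x (e2 R) (vorticity s)
  (\sum_(i <- s) i.1.1 * ((x.2 - i.2.2) *
     (480 * i.1.2 * cap 2 i.1.2 i.2 x - 800 * cap 3 i.1.2 i.2 x))).
Proof.
apply: is_derive_bigsum => i.
apply: is_derive_eq (is_deriveZ i.1.1 (is_deriveB
  (is_deriveZ 100 (is_derive_cap2 2 i.1.2 i.2 x))
  (is_deriveZ (80 * i.1.2) (is_derive_cap2 1 i.1.2 i.2 x)))) _.
rewrite /GRing.scale/=; ring.
Qed.

(** The least regular term is [cap 3], to which [Ck_cap] gives exactly the order 2; hence the
    exponent 5 in [stream]. *)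
Lemma Ck_vorticity s : Ck 2 (vorticity s).
Proof.
apply: Ck_sum => i; apply: CkM; first exact: Ck_cst.
have -> :
  (fun x => 100 * cap 4 i.1.2 i.2 x - 80 * i.1.2 * cap 3 i.1.2 i.2 x) =
    fun x => 100 * cap 4 i.1.2 i.2 x + - (80 * i.1.2) * cap 3 i.1.2 i.2 x.
  by apply/funext => x; rewrite mulNr.
apply: CkD; apply: CkM; [exact: Ck_cst| |exact: Ck_cst|exact: Ck_cap].
by apply: CkW; exact: Ck_cap.
Qed.

Lemma Ck_stream s : Ck 4 (stream s).
Proof. by apply: Ck_sum => i; apply: CkM; [exact: Ck_cst|exact: Ck_cap]. Qed.

Lemma box_supported_vorticity s : exists M, box_supported M (vorticity s).
Proof.
apply: box_supported_sum => i.
exists (`|i.1.2| + `|i.2.1| + `|i.2.2| + 1) => y hy.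
by rewrite !(box_supported_cap _ _ _ _ (lexx _))// !mulr0 subrr mulr0.
Qed.

Lemma box_supported_stream s : exists M, box_supported M (stream s).
Proof.
apply: box_supported_sum => i.
exists (`|i.1.2| + `|i.2.1| + `|i.2.2| + 1) => y hy.
by rewrite (box_supported_cap _ _ _ _ (lexx _))// mulr0.
Qed.

Lemma vorticityE s : vorticity s =
  fun x => - (partial1 (partial1 (stream s)) x + partial2 (partial2 (stream s)) x).
Proof.
apply/funext => x.
have -> : partial1 (stream s) = fun x =>
    \sum_(i <- s) (-10 * i.1.1) * ((x.1 - i.2.1) * cap 4 i.1.2 i.2 x).
  by apply/funext => y; apply: partial1E; exact: is_derive_stream1.
have -> : partial2 (stream s) = fun x =>
    \sum_(i <- s) (-10 * i.1.1) * ((x.2 - i.2.2) * cap 4 i.1.2 i.2 x).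
  by apply/funext => y; apply: partial2E; exact: is_derive_stream2.
rewrite (partial1E _ _ _ (is_derive_bigsum _ _ s _ _ _ _ (fun i =>
  is_deriveZ (-10 * i.1.1) (is_derive_moment11 2 i.1.2 i.2 x)))).
rewrite (partial2E _ _ _ (is_derive_bigsum _ _ s _ _ _ _ (fun i =>
  is_deriveZ (-10 * i.1.1) (is_derive_moment22 2 i.1.2 i.2 x)))).
rewrite -big_split/= -sumrN; apply: eq_bigr => i _.
(* This relation absorbs the squared distance to the centre. *)
have : cap 4 i.1.2 i.2 x = depth i.1.2 i.2 x * cap 3 i.1.2 i.2 x by exact: posXS.
rewrite /GRing.scale/= /depth => ->; ring.
Qed.

Lemma stream_schwarz s :
  partial1 (partial2 (stream s)) = partial2 (partial1 (stream s)).
Proof.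
apply/funext => x.
have -> : partial1 (stream s) = fun x =>
    \sum_(i <- s) (-10 * i.1.1) * ((x.1 - i.2.1) * cap 4 i.1.2 i.2 x).
  by apply/funext => y; apply: partial1E; exact: is_derive_stream1.
have -> : partial2 (stream s) = fun x =>
    \sum_(i <- s) (-10 * i.1.1) * ((x.2 - i.2.2) * cap 4 i.1.2 i.2 x).
  by apply/funext => y; apply: partial2E; exact: is_derive_stream2.
rewrite (partial1E _ _ _ (is_derive_bigsum _ _ s _ _ _ _ (fun i =>
  is_deriveZ (-10 * i.1.1) (is_derive_moment21 2 i.1.2 i.2 x)))).
rewrite (partial2E _ _ _ (is_derive_bigsum _ _ s _ _ _ _ (fun i =>
  is_deriveZ (-10 * i.1.1) (is_derive_moment12 2 i.1.2 i.2 x)))).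
apply: eq_bigr => i _; rewrite /GRing.scale/=; ring.
Qed.

Lemma inv_neg_laplacian_vorticity s : inv_neg_laplacian (vorticity s) = stream s.
Proof.
have [M sM] := box_supported_stream s.
have C2 : Ck 2 (stream s) := CkW _ _ (CkW _ _ (Ck_stream s)).
rewrite vorticityE.
exact: (inv_neg_laplacianK M (stream s) C2 sM (stream_schwarz s)).
Qed.

End Discs.

(** * The rotating configuration *)

Section Rotation.
Context {R : realType}.
Implicit Types (x : R * R) (a th phi t A : R).

(** The minus sign follows [rot], which turns clockwise: [rot a] sends [circle_pt th] to
    [circle_pt (th + a)]. *)
Definition circle_pt th : R * R := (cos th, - sin th).

(** A squared chord of the unit circle: in terms of the half-sum [g] and the half-difference [h] of
    the angles, [g] drops out. *)
Lemma dist_circle_pt a th :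
  ((circle_pt a).1 - (circle_pt th).1) ^+ 2 + ((circle_pt a).2 - (circle_pt th).2) ^+ 2
  = 4 * sin ((a - th) / 2) ^+ 2.
Proof.
set g := (a + th) / 2; set h := (a - th) / 2.
have ag : a = g + h by rewrite /g /h; field.
have tg : th = g - h by rewrite /g /h; field.
rewrite /circle_pt /= ag tg; rewrite !cosD !sinD !cosN !sinN.
have e : cos g ^+ 2 = 1 - sin g ^+ 2 by exact: cos2sin2.
transitivity (4 * sin h ^+ 2 * (cos g ^+ 2 + sin g ^+ 2)); first by ring.
by rewrite e; ring.
Qed.

(** [rot a] is an isometry carrying [circle_pt (th - a)] to [circle_pt th]. In the expansion, [q] is
    the scalar product of the rotated point with the centre. *)
Lemma depth_rot A th a x :
  depth A (circle_pt th) (Defs.rot a x) = depth A (circle_pt (th - a)) x.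
Proof.
rewrite /depth /Defs.rot /circle_pt /= cosB sinB; congr (_ - _).
have e : cos a ^+ 2 = 1 - sin a ^+ 2 by exact: cos2sin2.
have f : cos th ^+ 2 = 1 - sin th ^+ 2 by exact: cos2sin2.
set q := (cos a * x.1 + sin a * x.2) * cos th -
  (- sin a * x.1 + cos a * x.2) * sin th.
transitivity ((cos a ^+ 2 + sin a ^+ 2) * (x.1 ^+ 2 + x.2 ^+ 2) +
  (cos th ^+ 2 + sin th ^+ 2) - 2 * q); first by rewrite /q; ring.
transitivity ((x.1 ^+ 2 + x.2 ^+ 2) +
  (cos a ^+ 2 + sin a ^+ 2) * (cos th ^+ 2 + sin th ^+ 2) - 2 * q).
  by rewrite e f; ring.
by rewrite /q; ring.
Qed.

Lemma depth0_rot A a x : depth A 0 (Defs.rot a x) = depth A 0 x.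
Proof.
rewrite /depth /Defs.rot /= !subr0; congr (_ - _).
have e : cos a ^+ 2 = 1 - sin a ^+ 2 by exact: cos2sin2.
transitivity ((cos a ^+ 2 + sin a ^+ 2) * (x.1 ^+ 2 + x.2 ^+ 2)); first by ring.
by rewrite e; ring.
Qed.

Lemma is_derive_depth_circle A phi (l t : R) x :
  is_derive t (1 : R) (fun t => depth A (circle_pt (phi + l * t)) x)
    (- (2 * l * (x.1 * sin (phi + l * t) + x.2 * cos (phi + l * t)))).
Proof.
rewrite /depth /circle_pt /=.
have H : is_derive t (1 : R) (fun s : R => phi + l * s) l.
  by apply: is_derive_eq; rewrite /GRing.scale/=; ring.
have Hc := is_derive1_comp_fun cos (fun s : R => phi + l * s) t _ _
  (is_derive_cos (phi + l * t)) H.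
have Hs := is_derive1_comp_fun sin (fun s : R => phi + l * s) t _ _
  (is_derive_sin (phi + l * t)) H.
apply: is_derive_eq.
rewrite /GRing.scale/=; ring.
Qed.

End Rotation.

(** * The background, the vortex polygon and the transport equation *)

Section Solution.
Context {R : realType}.
Implicit Types (x : R * R) (a th phi t A : R).

(* The weights (-1)^j 'C(4, j) make the stream function a fourth difference of
   a quintic polynomial in [|x|^2], hence affine in [|x|^2] for [|x|^2 <= 4]. *)
Definition background : seq (@disc R) :=
  [:: (1, 4, 0); (-4, 5, 0); (6, 6, 0); (-4, 7, 0); (1, 8, 0)].

Definition angle (m j : nat) : R := 2 * pi * j%:R / m%:R.

Definition vortices (m : nat) A phi : seq (@disc R) :=
  [seq (1, A, circle_pt (angle m j + phi)) | j <- iota 0 m].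

Definition config (m : nat) A phi := background ++ vortices m A phi.

Lemma sum_config (m : nat) A phi (F : @disc R -> R) :
  \sum_(i <- config m A phi) F i =
  \sum_(i <- background) F i + \sum_(j < m) F (1, A, circle_pt (angle m j + phi)).
Proof.
have -> : \sum_(j < m) F (1, A, circle_pt (angle m j + phi)) =
  \sum_(j <- iota 0 m) F (1, A, circle_pt (angle m j + phi)).
  rewrite -(big_mkord xpredT (fun j => F (1, A, circle_pt (angle m j + phi)))).
  by rewrite /index_iota subn0.
by rewrite /config big_cat big_map.
Qed.

Lemma background_rot a x :
  vorticity background (Defs.rot a x) = vorticity background x.
Proof.
by rewrite /vorticity /background !big_cons !big_nil /cap /= !depth0_rot.
Qed.

Lemma circle_pt_periodic th : circle_pt (th + 2 * pi) = circle_pt th.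
Proof.
by rewrite /circle_pt mulr_natl cosD2pi sinD2pi.
Qed.

(** The background is radial, so a rotation only shifts the common phase of the vortices. *)
Lemma vorticity_rot (m : nat) A phi a x :
  vorticity (config m A phi) (Defs.rot a x) = vorticity (config m A (phi - a)) x.
Proof.
rewrite /vorticity !sum_config -!/(vorticity background _) background_rot.
by congr (_ + _); apply: eq_bigr => j _; rewrite /cap /= !depth_rot addrA.
Qed.

Lemma vorticity_fold (m : nat) A phi x : (0 < m)%N ->
  vorticity (config m A phi) (Defs.rot (2 * pi / m%:R) x) =
  vorticity (config m A phi) x.
Proof.
case: m => // m _; rewrite vorticity_rot /vorticity !sum_config; congr (_ + _).
(* The rotation permutes the vortices cyclically: the first one on the left matches the last one on
   the right up to a full turn, and the others match with indices shifted by one. *)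
rewrite big_ord_recl [RHS]big_ord_recr /= [LHS]addrC; congr (_ + _).
  apply: eq_bigr => j _.
  suff -> : angle m.+1 (lift ord0 j) + (phi - 2 * pi / m.+1%:R) =
    angle m.+1 j + phi by [].
  rewrite lift0 /angle -natr1; field.
  by rewrite nat1r pnatr_eq0.
suff -> : circle_pt (angle m.+1 m + phi) =
          circle_pt (angle m.+1 0 + (phi - 2 * pi / m.+1%:R)) by [].
rewrite -[RHS]circle_pt_periodic; congr circle_pt.
rewrite /angle -natr1; field.
by rewrite nat1r pnatr_eq0.
Qed.

Lemma exists_lower_bound (n : nat) (F : nat -> R) :
  (forall k, 0 < F k) -> exists2 A, 0 < A & forall k, (k < n)%N -> A <= F k.
Proof.
move=> F0; elim: n => [|n [A A0 IH]]; first by exists 1.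
exists (Num.min A (F n)); first by rewrite lt_min A0 F0.
move=> k; rewrite ltnS leq_eqVlt => /predU1P[->|/IH kA].
  by rewrite ge_min lexx orbT.
by rewrite ge_min kA.
Qed.

(** The sine is half the chord for an angle [pi * k / m]. Even [k] compare two vertices of the
    polygon; odd [k] compare a vertex with a point midway between neighbours, as
    [config_not_stationary] requires. *)
Definition separated (m : nat) A := forall k : nat, (0 < k < m.*2)%N ->
  A <= sin (pi * k%:R / m.*2%:R) ^+ 2.

Lemma exists_separated (m : nat) : exists A, [/\ 0 < A, A <= 1 & separated m A].
Proof.
(* The default value 1, taken at [k = 0], yields [A <= 1]. *)
pose F (k : nat) : R := if (0 < k < m.*2)%N then sin (pi * k%:R / m.*2%:R) ^+ 2 else 1.
have F0 k : 0 < F k.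
  rewrite /F; case: ifPn => // /andP[k0 km].
  have m0 : (0 < m.*2%:R :> R) by rewrite ltr0n (leq_ltn_trans _ km).
  rewrite exprn_gt0// sin_gt0_pi//; apply/andP; split.
    by apply: divr_gt0 => //; apply: mulr_gt0; rewrite ?ltr0n//; exact: pi_gt0.
  by rewrite ltr_pdivrMr// ltr_pM2l ?ltr_nat//; exact: pi_gt0.
have [A A0 AF] := exists_lower_bound m.*2.+1 F F0.
exists A; split => //.
  by have := AF 0%N isT.
by move=> k km; have := AF k; rewrite /F km; apply; case/andP: km => _ /ltnW.
Qed.

Lemma separated_sin (m j k : nat) A phi : separated m A ->
  (j < m)%N -> (k < m)%N -> j != k ->
  A <= sin ((angle m j + phi - (angle m k + phi)) / 2) ^+ 2.
Proof.
move=> sA; wlog jk : j k / (k < j)%N => [h jm km|].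
  rewrite neq_ltn => /orP[jk|kj]; last by apply: h; rewrite // gtn_eqF.
  rewrite -sqrrN -sinN -mulNr opprB; apply: h => //; by rewrite gtn_eqF.
move=> jm km _.
have m0 : (m%:R != 0 :> R) by rewrite pnatr_eq0 -lt0n (leq_ltn_trans _ km).
have -> : (angle m j + phi - (angle m k + phi)) / 2 = pi * (j - k).*2%:R / m.*2%:R.
  by rewrite /angle -!muln2 !natrM natrB 1?ltnW//; field.
by apply: sA; rewrite double_gt0 subn_gt0 jk/= ltn_double (leq_ltn_trans _ jm)// leq_subr.
Qed.

(** A point [x] in both discs would give [|p - q|^2 <= 2 * |x - p|^2 + 2 * |x - q|^2 < 4 * A] for
    the centres [p] and [q], against the length of their chord. *)
Lemma depth_disjoint A a th x : A <= sin ((a - th) / 2) ^+ 2 ->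
  0 < depth A (circle_pt a) x -> depth A (circle_pt th) x <= 0.
Proof.
move=> hA; have := dist_circle_pt a th; rewrite /depth.
move: (circle_pt a) (circle_pt th) => p q; rewrite subr_gt0 subr_le0 => pq px.
rewrite leNgt; apply/negP => qx.
have : (p.1 - q.1) ^+ 2 + (p.2 - q.2) ^+ 2 <= 2 * ((x.1 - p.1) ^+ 2 + (x.2 - p.2) ^+ 2)
    + 2 * ((x.1 - q.1) ^+ 2 + (x.2 - q.2) ^+ 2).
  rewrite -subr_ge0.
  have -> : 2 * ((x.1 - p.1) ^+ 2 + (x.2 - p.2) ^+ 2)
    + 2 * ((x.1 - q.1) ^+ 2 + (x.2 - q.2) ^+ 2) - ((p.1 - q.1) ^+ 2 + (p.2 - q.2) ^+ 2)
    = (2 * x.1 - p.1 - q.1) ^+ 2 + (2 * x.2 - p.2 - q.2) ^+ 2 by ring.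
  by rewrite addr_ge0 ?sqr_ge0.
lra.
Qed.

Lemma sum_active (m : nat) A phi x (F : nat -> R) (j : 'I_m) : separated m A ->
  0 < depth A (circle_pt (angle m j + phi)) x ->
  (forall k : nat, depth A (circle_pt (angle m k + phi)) x <= 0 -> F k = 0) ->
  \sum_(k < m) F k = F j.
Proof.
move=> sA dj F0; rewrite (bigD1 j)//= big1 ?addr0// => k kj.
apply: F0; apply: depth_disjoint dj; apply: separated_sin => //.
by rewrite eq_sym.
Qed.

(** Radial factors of the background: its stream function has gradient [-10 * background_quartic x]
    times [x], its vorticity [background_slope x] times [x]. *)
Let background_quartic x : R := \sum_(i <- background) i.1.1 * cap 4 i.1.2 i.2 x.
Let background_slope x : R := \sum_(i <- background)
  i.1.1 * (480 * i.1.2 * cap 2 i.1.2 i.2 x - 800 * cap 3 i.1.2 i.2 x).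

(** No truncation acts for [|x|^2 <= 4], so the weights take a fourth difference of polynomials in
    [A]: it is [4! = 24] for the fourth power and 0 for the cubic slope. *)
Lemma background_rigid x : x.1 ^+ 2 + x.2 ^+ 2 <= 4 ->
  background_quartic x = 24 /\ background_slope x = 0.
Proof.
move=> x4.
have bE n A : 4 <= A -> cap n A 0 x = (A - (x.1 ^+ 2 + x.2 ^+ 2)) ^+ n.
  move=> A4; rewrite /cap /depth !subr0 posX_ge0// subr_ge0; exact: le_trans A4.
rewrite /background_quartic /background_slope /background !big_cons !big_nil /=.
by rewrite !bE; [split; ring|lra..].
Qed.

(** The gradient of the [j]-th vortex at [x] is this number times [x] minus its centre. *)
Definition vortex_slope (m : nat) A phi x (j : nat) : R :=
  480 * A * cap 2 A (circle_pt (angle m j + phi)) x -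
  800 * cap 3 A (circle_pt (angle m j + phi)) x.

(* On the disc [|x|^2 <= 4] the velocity of the background is
   [-240 *: (x.2, - x.1)]: this is the origin of the angular velocity [-240]. *)
Definition vorticity_rate (m : nat) A phi x : R :=
  -240 * \sum_(j < m) (x.2 * (circle_pt (angle m j + phi)).1 -
     x.1 * (circle_pt (angle m j + phi)).2) * vortex_slope m A phi x j.

(* At a point of a vortex the background rotates rigidly and has constant
   vorticity, and the other vortices do not act; elsewhere everything is
   radial. *)
Lemma vorticity_transport (m : nat) A phi x : A <= 1 -> separated m A ->
  vorticity_rate m A phi x =
  - (partial2 (stream (config m A phi)) x * partial1 (vorticity (config m A phi)) x -
     partial1 (stream (config m A phi)) x * partial2 (vorticity (config m A phi)) x).
Proof.
move=> A1 sA; pose c j := circle_pt (angle m j + phi).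
pose b4 j := cap 4 A (c j) x.
have -> : partial1 (stream (config m A phi)) x =
    -10 * (x.1 * background_quartic x + \sum_(j < m) (x.1 - (c j).1) * b4 j).
  rewrite (partial1E _ _ _ (is_derive_stream1 _ x)) sum_config mulrDr.
  congr (_ + _); last by rewrite mulr_sumr; apply: eq_bigr => j _; rewrite mulr1.
  by rewrite /background_quartic !mulr_sumr /background !big_cons !big_nil /=; ring.
have -> : partial2 (stream (config m A phi)) x =
    -10 * (x.2 * background_quartic x + \sum_(j < m) (x.2 - (c j).2) * b4 j).
  rewrite (partial2E _ _ _ (is_derive_stream2 _ x)) sum_config mulrDr.
  congr (_ + _); last by rewrite mulr_sumr; apply: eq_bigr => j _; rewrite mulr1.
  by rewrite /background_quartic !mulr_sumr /background !big_cons !big_nil /=; ring.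
have -> : partial1 (vorticity (config m A phi)) x =
    x.1 * background_slope x + \sum_(j < m) (x.1 - (c j).1) * vortex_slope m A phi x j.
  rewrite (partial1E _ _ _ (is_derive_vorticity1 _ x)) sum_config.
  congr (_ + _); last by apply: eq_bigr => j _; rewrite mul1r.
  by rewrite /background_slope !mulr_sumr /background !big_cons !big_nil /=; ring.
have -> : partial2 (vorticity (config m A phi)) x =
    x.2 * background_slope x + \sum_(j < m) (x.2 - (c j).2) * vortex_slope m A phi x j.
  rewrite (partial2E _ _ _ (is_derive_vorticity2 _ x)) sum_config.
  congr (_ + _); last by apply: eq_bigr => j _; rewrite mul1r.
  by rewrite /background_slope !mulr_sumr /background !big_cons !big_nil /=; ring.
rewrite /vorticity_rate.
have b40 k : depth A (c k) x <= 0 -> b4 k = 0 by exact: posX_le0.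
have v0 k : depth A (c k) x <= 0 -> vortex_slope m A phi x k = 0.
  by move=> k0; rewrite /vortex_slope /cap !posX_le0// !mulr0 subrr.
case: (pickP (fun j : 'I_m => 0 < depth A (c j) x)) => [j dj|none]; last first.
  have off (k : 'I_m) : depth A (c k) x <= 0 by rewrite leNgt none.
  rewrite !big1; try (by move=> k _; rewrite ?b40 ?v0 ?mulr0).
  by ring.
rewrite (sum_active m A phi x (fun j =>
  (x.2 * (c j).1 - x.1 * (c j).2) * vortex_slope m A phi x j) j)//;
  last by move=> k /v0 ->; rewrite mulr0.
rewrite (sum_active m A phi x (fun j => (x.2 - (c j).2) * b4 j) j)//;
  last by move=> k /b40 ->; rewrite mulr0.
rewrite (sum_active m A phi x (fun j => (x.1 - (c j).1) * b4 j) j)//;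
  last by move=> k /b40 ->; rewrite mulr0.
rewrite (sum_active m A phi x (fun j =>
  (x.1 - (c j).1) * vortex_slope m A phi x j) j)//;
  last by move=> k /v0 ->; rewrite mulr0.
rewrite (sum_active m A phi x (fun j =>
  (x.2 - (c j).2) * vortex_slope m A phi x j) j)//;
  last by move=> k /v0 ->; rewrite mulr0.
(* The active vortex is centred on the unit circle and [A <= 1], so [|x|^2 <= 2 * A + 2 <= 4]: the
   point is in the rigid zone. *)
have [-> ->] : background_quartic x = 24 /\ background_slope x = 0.
  apply: background_rigid.
  have cj : (c j).1 ^+ 2 + (c j).2 ^+ 2 = 1 by rewrite /c /= sqrrN cos2Dsin2.
  move: dj cj; rewrite /depth; move: (c j) => p dj cj.
  have -> : x.1 ^+ 2 + x.2 ^+ 2 = 2 * ((x.1 - p.1) ^+ 2 + (x.2 - p.2) ^+ 2)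
     + 2 * (p.1 ^+ 2 + p.2 ^+ 2) - ((x.1 - 2 * p.1) ^+ 2 + (x.2 - 2 * p.2) ^+ 2) by ring.
  rewrite cj; have := sqr_ge0 (x.1 - 2 * p.1); have := sqr_ge0 (x.2 - 2 * p.2).
  lra.
(* The self-induced part cancels, both gradients of the active vortex being parallel to
   [x - c j]. *)
ring.
Qed.

(** The background is constant in time; for each vortex the chain rule through its moving depth
    produces [vortex_slope]. *)
Lemma is_derive_vorticity_time (m : nat) A x t :
  is_derive t (1 : R) (fun t => vorticity (config m A (-240 * t)) x)
    (vorticity_rate m A (-240 * t) x).
Proof.
under eq_fun do rewrite /vorticity sum_config.
have -> : vorticity_rate m A (-240 * t) x = 0 + \sum_(j < m)
    -240 * ((x.2 * (circle_pt (angle m j + -240 * t)).1 -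
     x.1 * (circle_pt (angle m j + -240 * t)).2) * vortex_slope m A (-240 * t) x j).
  by rewrite add0r /vorticity_rate mulr_sumr.
apply: is_deriveD; apply: is_derive_bigsum => j.
have D := is_derive_depth_circle A (angle m j) (-240) t x.
have D4 := is_derive1_comp_fun _ _ _ _ _ (is_derive_posX 2 _) D.
have D3 := is_derive1_comp_fun _ _ _ _ _ (is_derive_posX 1 _) D.
apply: is_derive_eq (is_deriveZ 1
  (is_deriveB (is_deriveZ 100 D4) (is_deriveZ (80 * A) D3))) _.
rewrite /GRing.scale/= /vortex_slope /cap /circle_pt /=; ring.
Qed.

End Solution.

(** * Non-stationarity and conclusion *)

Lemma is_derive_time_derivative (R : realType) (g : R -> R) (t d : R) :
  is_derive t (1 : R) g d -> is_time_derivative g t d.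
Proof.
move=> [dg <-]; rewrite /is_time_derivative.
apply: cvg_within_filter.
have -> : (fun h => h^-1 * (g (t + h) - g t)) =
    (fun h => h^-1 *: (g (h *: (1 : R) + t) - g t)).
  by apply/funext => h; rewrite /GRing.scale/= mulr1 (addrC t).
exact: dg.
Qed.

(** The point [circle_pt 0] is the centre of a vortex at time 0, where the vortices contribute
    [20 * A ^+ 4]. Once the polygon has turned by half a step, the point lies midway between two
    vortices, which contribute 0. *)
Lemma config_not_stationary (R : realType) (m : nat) (A : R) : (2 <= m)%N ->
  0 < A -> A <= 1 -> separated m A ->
  ~ stationary (fun x t => vorticity (config m A (-240 * t)) x).
Proof.
move=> m2 A0 A1 sA st.
have m0 : 0 < m%:R :> R by rewrite ltr0n (leq_trans _ m2).
(* At angular velocity [-240], the time of a turn by [pi / m]. *)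
pose t : R := pi / (240 * m%:R).
have t0 : 0 <= t by rewrite divr_ge0 ?pi_ge0 ?mulr_ge0 ?ltW.
have := st (circle_pt 0) t t0.
have off (th : R) : A <= sin ((0 - th) / 2) ^+ 2 ->
    100 * cap 4 A (circle_pt th) (circle_pt 0) -
    80 * A * cap 3 A (circle_pt th) (circle_pt 0) = 0.
  move=> hA; have d0 : depth A (circle_pt th) (circle_pt 0) <= 0.
    by rewrite /depth dist_circle_pt subr_le0; lra.
  by rewrite /cap !posX_le0// !mulr0 subrr.
rewrite /vorticity !sum_config => /addrI.
rewrite [LHS]big1 => [|j _]; last first.
  rewrite mul1r; apply: off.
  have -> : (0 - (angle m j + -240 * t)) / 2 = pi * (1 - j.*2%:R) / m.*2%:R.
    by rewrite /angle /t -!muln2 !natrM; field; rewrite gt_eqF.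
  (* The index in [separated] is odd: 1 for [j = 0], and [2 * j - 1] after a change of sign
     otherwise. *)
  have [->|j0] := posnP j.
    by rewrite subr0; apply: (sA 1%N); rewrite (leq_trans m2)// -addnn leq_addr.
  rewrite -sqrrN -sinN -mulNr -mulrN opprB.
  have -> : j.*2%:R - 1 = j.*2.-1%:R :> R.
    by rewrite -[in LHS](prednK (n := j.*2)) ?double_gt0// -natr1 addrK.
  apply: sA; rewrite (leq_ltn_trans (leq_pred _)) ?ltn_double// andbT.
  by rewrite -subn1 subn_gt0 -addnn (leq_add j0 j0).
rewrite (bigD1 (Ordinal (ltnW m2)))//= [X in _ + X]big1 ?addr0 => [|j j0]; last first.
  rewrite mul1r; apply: off.
  have -> : (0 - (angle m j + -240 * 0)) / 2 = - (pi * j.*2%:R / m.*2%:R) :> R.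
    by rewrite /angle -!muln2 !natrM; field; rewrite gt_eqF.
  rewrite sinN sqrrN; apply: sA; rewrite double_gt0 ltn_double ltn_ord andbT lt0n.
  exact: j0.
have -> : angle m 0 + -240 * 0 = 0 :> R by rewrite /angle !mulr0 mul0r addr0.
have dA : depth A (circle_pt 0) (circle_pt 0) = A.
  by rewrite /depth !subrr expr0n/= addr0 subr0.
rewrite /cap dA !posX_ge0 ?ltW// => /eqP; rewrite eq_sym => /eqP e.
have : 0 < A ^+ 4 by exact: exprn_gt0.
have -> : A ^+ 4 = (1 * (100 * A ^+ 4 - 80 * A * A ^+ 3)) / 20 by field.
by rewrite e mul0r ltxx.
Qed.

Theorem corollary2p2 (R : realType) (m : nat) (hm : (2 <= m)%N) :
  exists w : R * R -> R -> R,
    [/\ global_rotating_solution w,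
        ~ stationary w &
        forall t : R, 0 <= t ->
          [/\ Ck 2 (w^~ t),
              compactly_supported (w^~ t) &
              fold_symmetric m (w^~ t)]].
Proof.
have [A [A0 A1 sA]] := @exists_separated R m.
exists (fun x t => vorticity (config m A (-240 * t)) x).
split; [split| |].
- move=> t t0; split.
  + exact: (Ck_vorticity _).1.
  + by rewrite inv_neg_laplacian_vorticity; exact: (Ck_stream _).1.
  + move=> x; apply: is_derive_time_derivative.
    (* The potential of the vorticity is [stream], so the velocity is explicit and the equation is
       [vorticity_transport]. *)
    rewrite /velocity inv_neg_laplacian_vorticity /perp_grad /= (mulNr (partial1 _ x)).
    have := is_derive_vorticity_time m A x t.
    by rewrite (vorticity_transport m A _ x A1 sA).
- exists (-240) => x t t0.
  by rewrite vorticity_rot subrr mulr0.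
- exact: config_not_stationary.
- move=> t t0; split.
  + exact: Ck_vorticity.
  + have [M] := box_supported_vorticity (config m A (-240 * t)).
    exact: box_supported_compact.
  + by move=> x; apply: vorticity_fold; exact: leq_trans hm.
Qed.
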